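(* Let $\mathbb{F}_q$ be a finite field and let $m$ be a positive integer with $\gcd(m,q)=1$, with prime factorization $m=\ell_1^{e_1}\cdots\ell_s^{e_s}$, $\ell_1<\cdots<\ell_s$. Let $a(T),b(T)\in\mathbb{F}_q[T]$ be nonconstant monic polynomials, neither of which is an $\ell_i$-th power in $\mathbb{F}_q(T)$ for any $i=1,\dots,s$. Fix a power $q^k$ of $q$ and a congruence class $n_0+q^k\mathbb{Z}\in\mathbb{Z}/q^k\mathbb{Z}$. Then there is a constant $c=c(m,a,b,q^k)>0$ such that $$\deg\Big(\gcd\big(\Phi_m(a(T)^n),\Phi_m(b(T)^n)\big)\Big)\ge cn$$ for infinitely many positive integers $n\equiv n_0 \pmod{q^k}$.
   Context: $\Phi_m(x)$ denotes the $m$-th cyclotomic polynomial (with integer coefficients, reduced into $\mathbb{F}_q[x]$); the gcd is taken in $\mathbb{F}_q[T]$. *)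

(* Defs.v *)
From HB Require Import structures.
From mathcomp Require Import all_boot all_order all_algebra all_field.
Set Implicit Arguments. Unset Strict Implicit. Unset Printing Implicit Defensive.
Import Order.TTheory GRing.Theory Num.Theory.
Local Open Scope ring_scope.

Definition PhiF (F : finFieldType) (m : nat) : {poly F} :=
  map_poly (intr : int -> F) ('Phi_m).

Definition is_pow_in_FT (F : finFieldType) (l : nat) (p : {poly F}) : Prop :=
  exists f : {fraction {poly F}}, f ^+ l = tofrac p.

(* Main.v *)
Require Import Defs.
From HB Require Import structures.
From mathcomp Require Import all_boot all_order all_algebra all_field.
From mathcomp Require Import cyclic ring zify.
Set Implicit Arguments. Unset Strict Implicit. Unset Printing Implicit Defensive.
Import Order.TTheory GRing.Theory Num.Theory.
Local Open Scope ring_scope.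

(** Enlarge the constant field until [a] and [b] split, [a = prod_i (X - b_i)^(e_i)],
    and [m] divides [q - 1].  Take [n = n1 (q^N - 1) / m] with [n1 = 1 mod m] and [n1]
    adjusted to the prescribed class.  If [p] is irreducible of degree [s | N] with root
    [z], then [(z - b_i)^((q^N - 1)/(q - 1)) = (-1)^N p(b_i)^(N/s)], so whether [p]
    divides both [Phi_m(a^n)] and [Phi_m(b^n)] is decided by the m-th power residue
    classes of the [p(b_i)].  Some choice of these classes works for [a] and [b]
    simultaneously (choose modulo each prime dividing [m], then use the Chinese remainder
    theorem), and it remains to show that irreducible polynomials with prescribed classes
    at the [b_i] are responsible for a positive proportion of the [q^N] elements of the
    extension of degree [N], for infinitely many [N].

    The classes are detected by characters [chi_r] of monic polynomials.  For [r <> 0] the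
    series [L_r(u) = sum_g chi_r(g) u^(deg g)] is a polynomial by Lagrange interpolation,
    and [u L_r'/L_r] is the generating series of the sums [S_j(r)] over prime powers.
    If the product [P] of these [L_r] vanished at [1/q], then [P/(1 - q u)] would be a
    polynomial with logarithmic derivative having nonnegative coefficients and positive
    first coefficient, hence with all coefficients positive: impossible.  Finally the
    recurrence with symbol [P] kills all the [S_j(r)], but multiplies the main term [q^j]
    by [P(1/q) <> 0], so the count cannot be [o(q^N)].  No bound on the zeros of [L_r]
    is needed. *)

(** * Logarithmic derivatives and Newton's identities *)

Section Newton.
Variable R : fieldType.
Implicit Types (p q : {poly R}) (S T : nat -> R).

(* The logarithmic derivative [X p' / p] is the power series [sum_(j > 0) S j X^j];
   the value of [S] at [0] is irrelevant. *)
Definition newton p S :=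
  forall n, 'X^n %| 'X * p^`() - p * ('X * \poly_(j < n) S j.+1).

(** Comparing coefficients turns the congruences modulo all [X^n] into Newton's identities, a
    recurrence that determines [p] from [S] and [p(0)] in characteristic zero. *)
Lemma newtonP p S :
  newton p S <->
  (forall n, p`_n *+ n = \sum_(j < n) S j.+1 * p`_(n - j.+1)).
Proof.
have coefE n i : (i <= n)%N ->
  ('X * p^`() - p * ('X * \poly_(j < n) S j.+1))`_i
  = p`_i *+ i - \sum_(j < i) S j.+1 * p`_(i - j.+1).
  move=> le_in; rewrite coefB; congr (_ - _).
    by case: i le_in => [|i] _; rewrite coefXM ?mulr0n //= coef_deriv.
  rewrite mulrCA coefXM; case: i le_in => [|i] le_in; first by rewrite big_ord0.
  rewrite mulrC coefM /=; apply: eq_bigr => j _.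
  by rewrite coef_poly (leq_trans (ltn_ord j)) // subSS.
split=> H n.
  have /dvdpP [r Hr] := H n.+1.
  by apply/eqP; rewrite -subr_eq0 -(coefE n.+1) // Hr coefMXn ltnSn.
set r := _ - _.
have -> : r = drop_poly n r * 'X^n.
  rewrite -[LHS](poly_take_drop n) [take_poly _ _](_ : _ = 0) ?add0r //.
  apply/polyP=> i; rewrite coef_take_poly coef0; case: ltnP => // lt_in.
  by rewrite coefE ?(ltnW lt_in) // H subrr.
exact: dvdp_mulIr.
Qed.

Lemma newtonM p q S T :
  newton p S -> newton q T -> newton (p * q) (fun j => S j + T j).
Proof.
move=> HS HT n.
have -> : \poly_(j < n) (S j.+1 + T j.+1)
   = \poly_(j < n) S j.+1 + \poly_(j < n) T j.+1.
  by apply/polyP => i; rewrite coefD !coef_poly; case: ifP; rewrite ?addr0.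
have -> : forall s t : {poly R}, 'X * (p * q)^`() - p * q * ('X * (s + t))
  = ('X * p^`() - p * ('X * s)) * q + p * ('X * q^`() - q * ('X * t)).
  by move=> s t; rewrite derivM; ring.
exact: dvdp_add (dvdp_mulr _ (HS n)) (dvdp_mull _ (HT n)).
Qed.

(** The logarithmic derivative turns products into sums; since [p(0)] is nonzero, [p] is coprime to
    [X^n] and cancels from the congruence. *)
Lemma newton_cancel p q S T : p`_0 != 0 ->
  newton p S -> newton (p * q) T -> newton q (fun j => T j - S j).
Proof.
move=> p0 HS HT n.
have cop : coprimep 'X^n p.
  by rewrite coprimep_expl // coprimep_sym coprimepX /root horner_coef0.
rewrite -(Gauss_dvdpr _ cop).
have -> : \poly_(j < n) (T j.+1 - S j.+1)
   = \poly_(j < n) T j.+1 - \poly_(j < n) S j.+1.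
  by apply/polyP => i; rewrite coefB !coef_poly; case: ifP; rewrite ?subr0.
have -> : forall s t : {poly R}, p * ('X * q^`() - q * ('X * (t - s)))
  = ('X * (p * q)^`() - p * q * ('X * t)) - ('X * p^`() - p * ('X * s)) * q.
  by move=> s t; rewrite derivM; ring.
exact: dvdp_sub (HT n) (dvdp_mulr _ (HS n)).
Qed.

Lemma newton_eq p S T : (forall j, S j.+1 = T j.+1) -> newton p S -> newton p T.
Proof.
by move=> eqST /newtonP H; apply/newtonP => n; rewrite H; under eq_bigr do rewrite eqST.
Qed.

Lemma newton_prod (I : finType) (P : pred I) (L : I -> {poly R}) (S : I -> nat -> R) :
  (forall i, P i -> newton (L i) (S i)) ->
  newton (\prod_(i | P i) L i) (fun j => \sum_(i | P i) S i j).
Proof.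
move=> H.
have: forall s : seq I, newton (\prod_(i <- s | P i) L i) (fun j => \sum_(i <- s | P i) S i j).
  elim=> [|i s IH].
    apply/newtonP => n; rewrite big_nil coef1 big1 => [|j _]; last by rewrite big_nil mul0r.
    by case: n => [|n]; rewrite ?mulr0n //= mul0rn.
  rewrite big_cons; case: ifPn => Pi.
    apply: newton_eq (newtonM (H i Pi) IH) => j.
    by rewrite big_cons Pi.
  by apply: newton_eq IH => j; rewrite big_cons (negPf Pi).
exact.
Qed.

(** Expand [-cX / (1 - cX)] as a geometric series. *)
Lemma newton_geom (c : R) : newton (1 - c *: 'X) (fun j => - c ^+ j).
Proof.
apply/newtonP => n.
have E i : (1 - c *: 'X : {poly R})`_i = (i == 0%N)%:R - c * (i == 1%N)%:R.
  by rewrite coefB coef1 coefZ coefX.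
under eq_bigr do rewrite E; rewrite E.
case: n => [|[|n]]; rewrite ?big_ord0 ?mulr0n // ?big_ord1 /=; first by ring.
rewrite !big_ord_recr /= big1 => [|j _].
  by rewrite subnn subSnn /= mulr0 subrr mul0rn [c ^+ n.+2]exprS; ring.
have /andP[/negPf-> /negPf->] : (n.+2 - j.+1 != 0)%N && (n.+2 - j.+1 != 1)%N.
  by have := ltn_ord j; lia.
by rewrite mulr0 subrr mulr0.
Qed.

End Newton.

(** * Nonvanishing at [1/q] and linear recurrences *)

Section NonVanishing.
Variables (R : numFieldType) (q : nat).

(** In Newton's recurrence the term with [T 1] is positive and the others are nonnegative, so by
    induction every coefficient of [p] is positive, whereas a polynomial has only finitely many
    nonzero ones. *)
Lemma newton_pos (p : {poly R}) (T : nat -> R) : p`_0 = 1 -> newton p T ->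
  (forall j, 0 <= T j.+1) -> 0 < T 1 -> False.
Proof.
move=> p0 /newtonP H T0 T1.
have pos n : 0 < p`_n.
  elim/ltn_ind: n => -[|n] IH; first by rewrite p0 ltr01.
  rewrite -(@pmulrn_lgt0 _ _ n.+1) // H big_ord_recl /= subSS subn0.
  rewrite ltr_pwDl ?mulr_gt0 ?IH // sumr_ge0 // => j _.
  by rewrite mulr_ge0 // ltW // IH // /bump /=; lia.
by have := pos (size p); rewrite nth_default ?ltxx.
Qed.

Lemma newton_nonvanishing (p : {poly R}) (S : nat -> R) : (0 < q)%N ->
  p`_0 = 1 -> newton p S -> (forall j, 0 <= q%:R ^+ j.+1 + S j.+1) ->
  0 < q%:R + S 1%N -> p.[q%:R^-1] != 0.
Proof.
move=> q0 p0 HS T0 T1; apply/negP => /factor_theorem [r pE].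
have qN0 : q%:R != 0 :> R by rewrite pnatr_eq0 -lt0n.
(* Rescaling the factor [X - 1/q] to [1 - qX] gives the cofactor constant term 1, and dividing by
   [1 - qX] adds [q^j] to [S j]. *)
have p1E : p = (1 - q%:R *: 'X) * (- q%:R^-1 *: r).
  have e : q%:R%:P * (q%:R^-1)%:P = 1 :> {poly R} by rewrite -polyCM mulfV.
  rewrite pE scaleNr -!mul_polyC.
  transitivity (q%:R%:P * (q%:R^-1)%:P * (r * 'X) - r * (q%:R^-1)%:P); last by ring.
  by rewrite e; ring.
have g0 : (1 - q%:R *: 'X : {poly R})`_0 = 1.
  by rewrite coefB coef1 coefZ coefX mulr0 subr0.
rewrite p1E in p0 HS.
have r0 : (- q%:R^-1 *: r)`_0 = 1.
  by move: p0; rewrite -horner_coef0 hornerM !horner_coef0 g0 mul1r.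
have g0n : (1 - q%:R *: 'X : {poly R})`_0 != 0 by rewrite g0 oner_neq0.
apply: (newton_pos r0 (newton_cancel g0n (newton_geom _) HS)) => [j|] /=.
  by rewrite opprK addrC T0.
by rewrite opprK addrC expr1.
Qed.

(** Multiplying by [r] the relation between [X p'] and [p] gives [p r] times the series of [S] equal
    to [X p' r], whose degree is less than [n]; hence the coefficient of [X^n] vanishes. *)
Lemma newton_recurrence (p r : {poly R}) (S : nat -> R) n :
  newton p S -> (size p + size r < n)%N ->
  \sum_(i < size (p * r)) (p * r)`_i * S (n - i)%N = 0.
Proof.
move=> H lt_n.
have le_n : (size (p * r)%R <= n)%N by have := size_polyMleq p r; lia.
have /dvdpP [u Hu] := H n.+1.
have : ((p * r) * ('X * \poly_(j < n.+1) S j.+1))`_n = 0.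
  have -> : (p * r) * ('X * \poly_(j < n.+1) S j.+1)
      = 'X * p^`() * r - u * r * 'X^(n.+1).
    by rewrite [X in _ - X]mulrAC -Hu; ring.
  rewrite coefB coefMXn ltnSn subr0 nth_default //.
  have [->|/lt_size_deriv lt_p] := eqVneq p 0.
    by rewrite deriv0 mulr0 mul0r size_poly0.
  apply: leq_trans (size_polyMleq _ _) _.
  have le_X : (size ('X * p^`())%R <= (size p^`()).+1)%N.
    by apply: leq_trans (size_polyMleq _ _) _; rewrite size_polyX.
  by move: le_X lt_p lt_n; move: (size _) (size _) (size p) (size r); lia.
move=> H0; rewrite -[RHS]H0 coefM.
rewrite (big_ord_widen n.+1 (fun i => (p * r)`_i * S (n - i)%N)); last exact: ltnW.
rewrite big_mkcond; apply: eq_bigr => i _; case: ltnP => hi; last first.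
  by rewrite [(p * r)`_i]nth_default ?mul0r.
rewrite coefXM coef_poly; have ni : (i < n)%N by apply: leq_trans hi le_n.
rewrite subn_eq0 leqNgt ni /= prednK ?subn_gt0 //.
by rewrite (leq_trans _ (leq_subr i n.+1)) ?prednK ?subn_gt0 // ?subSn //; lia.
Qed.

End NonVanishing.

(* The recurrence with symbol [prod L] kills every [S i], whereas it
   multiplies the main term [q ^ j] by the value of [prod L] at [1 / q]. *)
Lemma recurrent_density (I : finType) (P : pred I) (L : I -> {poly algC})
    (S : I -> nat -> algC) (w : I -> algC) (q c0 d : nat) (C delta : nat -> nat) :
  (1 < q)%N -> (forall i, P i -> newton (L i) (S i)) ->
  (\prod_(i | P i) L i).[q%:R^-1] != 0 ->
  (forall j, delta j <= d)%N ->
  (forall j, (0 < j)%N ->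
    (c0 * C j)%:R = q%:R ^+ j - (delta j)%:R + \sum_(i | P i) w i * S i j) ->
  exists2 M, (0 < M)%N & forall N0, exists2 N, (N0 < N)%N & (q ^ N <= M * C N)%N.
Proof.
move=> q1 HL Pq ld HC; set Pi := \prod_(i | P i) L i in Pq.
pose K := \sum_(k < size Pi) `|Pi`_k|; pose eps := `|Pi.[q%:R^-1]|.
have eps0 : 0 < eps by rewrite normr_gt0.
have K0 : 0 <= K by apply: sumr_ge0.
have qR0 : q%:R != 0 :> algC by rewrite pnatr_eq0; lia.
have nn t : 0 <= 2 * K * t%:R / eps.
  by apply: divr_ge0; [rewrite !mulr_ge0 | exact: ltW].
(* If every count in the window below were less than [q^j / M], one would get
   [M q^N eps <= K (c0 q^N + M d)]. This [M] makes [K c0 q^N] less than half of the left side, and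
   [N1] below does the same for [K M d]. *)
pose M := Num.bound (2 * K * c0%:R / eps).
have MP : 2 * K * c0%:R < M%:R * eps.
  by rewrite -ltr_pdivrMr // archi_boundP.
have M0 : (0 < M)%N.
  rewrite lt0n; apply/eqP => M0; move: MP; rewrite M0 mul0r.
  by rewrite le_gtF // !mulr_ge0.
exists M => // N0.
pose N1 := Num.bound (2 * K * d%:R / eps).
have N1P : 2 * K * d%:R < N1%:R * eps.
  by rewrite -ltr_pdivrMr // archi_boundP.
(* For each [i], [Pi] is [L i] times the remaining factors; [B] makes [N] large enough for
   [newton_recurrence] in all these factorizations at once. *)
pose B := \max_(i | P i) (size (L i) + size (\prod_(j | P j && (j != i)) L j)%R)%N.
pose N := (N0 + N1 + B + size Pi).+1.
have N1q : N1%:R <= q%:R ^+ N :> algC.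
  by rewrite -natrX ler_nat (leq_trans (ltnW (ltn_expl N1 q1))) // leq_exp2l // /N; lia.
have rec : q%:R ^+ N * Pi.[q%:R^-1]
    = \sum_(k < size Pi) Pi`_k * (c0 * C (N - k)%N + delta (N - k)%N)%:R.
  have E (k : 'I_(size Pi)) : Pi`_k * (c0 * C (N - k)%N + delta (N - k)%N)%:R
    = Pi`_k * q%:R ^+ (N - k) + \sum_(i | P i) w i * (Pi`_k * S i (N - k)%N).
    rewrite natrD HC; last by have := ltn_ord k; rewrite /N; lia.
    rewrite addrAC subrK mulrDr mulr_sumr; congr (_ + _).
    by apply: eq_bigr => i _; ring.
  rewrite (eq_bigr _ (fun k _ => E k)) big_split /= exchange_big /=.
  rewrite [X in _ + X]big1 ?addr0 => [|i Pi_i].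
    rewrite horner_coef mulr_sumr; apply: eq_bigr => k _.
    rewrite mulrCA exprVn expfB_cond // (negPf qR0) add0n.
    by rewrite ltnW // ltnS (leq_trans (ltnW (ltn_ord k))) // leq_addl.
  rewrite -mulr_sumr; suff -> : \sum_(k < size Pi) Pi`_k * S i (N - k)%N = 0 by rewrite mulr0.
  rewrite /Pi (bigD1 i) //=; apply: newton_recurrence; first exact: HL.
  apply: (@leq_trans B.+1); last by rewrite /N; lia.
  rewrite ltnS; pose G i := (size (L i) + size (\prod_(j | P j && (j != i)) L j)%R)%N.
  exact: (leq_bigmax_cond (F := G)).
(* The recurrence involves only the indices [N - k] with [k < size Pi], so one of these must have a
   large count. *)
have [/existsP[k Hk]|] := boolP [exists k : 'I_(size Pi), (q ^ (N - k) <= M * C (N - k))%N].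
  by exists (N - k)%N => //; have := ltn_ord k; rewrite /N; lia.
rewrite negb_exists => /forallP small; exfalso.
have : M%:R * (q%:R ^+ N * eps) <= K * (c0%:R * q%:R ^+ N + M%:R * d%:R).
  have -> : q%:R ^+ N * eps = `|q%:R ^+ N * Pi.[q%:R^-1]|.
    by rewrite normrM normrX normr_nat.
  rewrite rec mulr_suml; apply: le_trans (ler_wpM2l _ (ler_norm_sum _ _ _)) _ => //.
  rewrite mulr_sumr; apply: ler_sum => k _.
  rewrite normrM normr_nat mulrCA ler_wpM2l // -natrX -!natrM -!natrD ler_nat.
  have := small k; rewrite -ltnNge => sk.
  have le_q : (q ^ (N - k) <= q ^ N)%N by rewrite leq_exp2l // leq_subr.
  have := ld (N - k)%N => ldk.
  rewrite mulnDr mulnCA leq_add ?leq_mul //.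
  by rewrite (leq_trans (ltnW sk)).
have qN0 : 0 < q%:R ^+ N :> algC by rewrite exprn_gt0 // ltr0n; lia.
have H1 : 2 * K * c0%:R * q%:R ^+ N < M%:R * eps * q%:R ^+ N by rewrite ltr_pM2r.
have H2 : M%:R * (2 * K * d%:R) < M%:R * (q%:R ^+ N * eps).
  by rewrite ltr_pM2l ?ltr0n // (lt_le_trans N1P) // ler_pM2r.
rewrite -(@ler_pM2l _ 2) ?ltr0n //; apply/negP; rewrite lt_geF //.
have dbl (x c y z t : algC) :
    2 * (x * (c * y + z * t)) = 2 * x * c * y + z * (2 * x * t) by ring.
rewrite dbl (_ : 2 * (M%:R * _) = M%:R * eps * q%:R ^+ N + M%:R * (q%:R ^+ N * eps)).
  exact: ltrD.
by rewrite -mulrA [eps * _]mulrC -mulr2n mulr_natl.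
Qed.

(** * Monic polynomials, unique factorization and the Euler product *)

Section Monics.
Variable F : finFieldType.
Implicit Types (g h p : {poly F}).

Definition monics n : seq {poly F} := [seq 'X^n + rVpoly v | v : 'rV[F]_n].

Lemma mem_monics n g : (g \in monics n) = (g \is monic) && (size g == n.+1).
Proof.
apply/imageP/andP => [[v _ ->]|[g_mon /eqP sg]].
  have sv : (size (rVpoly v) < n.+1)%N by rewrite ltnS size_poly.
  have sX : (size (rVpoly v) < size ('X^n : {poly F}))%N by rewrite size_polyXn.
  split; last by rewrite size_polyDl // size_polyXn.
  by rewrite monicE lead_coefDl // lead_coefXn.
exists (poly_rV (take_poly n g)) => //.
rewrite poly_rV_K ?size_take_poly // -[LHS](poly_take_drop n) addrC; congr (_ + _).
rewrite -[RHS]mul1r; congr (_ * _).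
apply/polyP => i; rewrite coef_drop_poly coef1; case: i => [|i] /=.
  by move: g_mon; rewrite monicE lead_coefE sg => /eqP.
by rewrite nth_default // sg addSn ltnS leq_addl.
Qed.

Lemma uniq_monics n : uniq (monics n).
Proof.
rewrite map_inj_uniq ?enum_uniq // => u v /addrI; exact: can_inj (@rVpolyK _ _) _ _.
Qed.

Lemma size_monics n : size (monics n) = (#|F| ^ n)%N.
Proof. by rewrite size_image card_mx mul1n. Qed.

Definition irrs n := [seq p <- monics n | irreducibleb p].

Lemma irrsP n p :
  reflect [/\ p \is monic, size p = n.+1 & irreducible_poly p] (p \in irrs n).
Proof.
rewrite mem_filter mem_monics.
apply: (iffP and3P) => [[/irreducibleP ? ? /eqP ?]|[? ? ?]]; split=> //.
  exact/irreducibleP.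
exact/eqP.
Qed.

Lemma uniq_irrs n : uniq (irrs n).
Proof. by rewrite filter_uniq ?uniq_monics. Qed.

Lemma irreducible_dvd_exists g : (1 < size g)%N ->
  exists p, [/\ p \is monic, irreducible_poly p & p %| g].
Proof.
have [n] := ubnP (size g); elim: n g => // n IH g lt_n g1.
have g0 : g != 0 by rewrite -size_poly_gt0 ltnW.
have [/irreducibleP irr|] := boolP (irreducibleb g).
  exists ((lead_coef g)^-1 *: g); split.
  - by rewrite monicE lead_coefZ mulVf // lead_coef_eq0.
  - have := irr; rewrite /irreducible_poly => -[_ Hd].
    rewrite size_scale ?invr_eq0 ?lead_coef_eq0 //; split=> // q q1.
    rewrite dvdpZr ?invr_eq0 ?lead_coef_eq0 // => /(Hd q q1) eq.
    by rewrite (eqp_trans eq) // eqp_sym eqp_scale // invr_eq0 lead_coef_eq0.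
  by rewrite dvdpZl ?dvdpp // invr_eq0 lead_coef_eq0.
rewrite /irreducibleb g1 /= negb_forall => /existsP [q].
rewrite negb_imply -ltnNge => /andP[dq q1].
have {}dq : (q : {poly F}) %| g by rewrite dvdpE.
have lt_q : (size q < n)%N.
  by apply: leq_ltn_trans (size_npoly q) _; rewrite (ltn_predK g1).
have [p [mp ip dp]] := IH _ lt_q q1.
by exists p; split=> //; apply: dvdp_trans dp dq.
Qed.

Lemma coprimep_irreducible p p' : p \is monic -> p' \is monic ->
  irreducible_poly p -> irreducible_poly p' -> p != p' -> coprimep p p'.
Proof.
move=> mp mp' ip ip' neq; have [_ Hd] := ip'.
rewrite irreducible_poly_coprime //; apply/negP => /Hd.
case: ip => s1 _; rewrite neq_ltn s1 orbT => /(_ isT).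
by rewrite eqp_monic // (negPf neq).
Qed.

(** Splitting off an irreducible factor [p0] lowers the multiplicity of [p0] by one and leaves those
    of the other irreducibles unchanged, so both sides drop by the degree of [p0]. The bound [B]
    stays fixed along the induction. *)
Lemma irr_multiplicity B n g : (n <= B)%N -> g \in monics n ->
  (\sum_(d < B.+1) \sum_(p <- irrs d) \sum_(k < B) (p ^+ k.+1 %| g)%R * d)%N = n.
Proof.
elim/ltn_ind: n g => n IH g le_nB; rewrite mem_monics => /andP[g_mon /eqP sg].
have [n0|n_gt0] := posnP n.
  rewrite n0 in sg *; rewrite big1 // => d _; rewrite big_seq big1 // => p.
  case/irrsP => mp sp [p1 _]; rewrite big1 // => k _.
  suff -> : (p ^+ k.+1 %| g)%R = false by [].
  apply/negP => /dvdp_leq; rewrite -size_poly_gt0 sg => /(_ isT).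
  rewrite leqNgt => /negP; apply.
  rewrite (leq_trans p1) // exprS size_monicM ?expf_neq0 // ?monic_neq0 //.
  by rewrite -subn1 -addnBA ?leq_addr // size_poly_gt0 expf_neq0 ?monic_neq0.
have [|p0 [mp0 ip0 /dvdpP[g' gE]]] := @irreducible_dvd_exists g; first by rewrite sg.
have mg' : g' \is monic by move: g_mon; rewrite gE monicMr.
rewrite mulrC in gE.
have sz : (size g = (size p0 + size g').-1)%N.
  by rewrite gE size_monicM ?monic_neq0.
have sp0 := ip0.1.
have sg'0 : (0 < size g')%N by rewrite size_poly_gt0 monic_neq0.
set d0 := (size p0).-1; set n' := (size g').-1.
have nE : n = (n' + d0)%N.
  by move: sz; rewrite sg /n' /d0; move: (size p0) sp0 (size g') sg'0; lia.
have d0_gt0 : (0 < d0)%N by rewrite /d0; move: (size p0) sp0; lia.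
have g'm : g' \in monics n' by rewrite mem_monics mg' /= prednK.
have lt_n'n : (n' < n)%N by lia.
rewrite [RHS]nE -(IH n' lt_n'n g' _ g'm); last by lia.
have d0B : (d0 < B.+1)%N by lia.
have <- : (\sum_(d < B.+1) \sum_(p <- irrs d) (p == p0) * d = d0)%N.
  rewrite (bigD1 (Ordinal d0B)) //= [X in (_ + X)%N]big1 ?addn0 => [|d neq_d].
    rewrite (bigD1_seq p0) ?uniq_irrs //= ?eqxx ?mul1n ?big1 ?addn0 //.
      by move=> p /negPf->.
    by apply/irrsP; rewrite prednK // ltnW.
  rewrite big_seq big1 // => p /irrsP[_ sp _]; case: eqP => // pE.
  by case/eqP: neq_d; apply/val_inj; rewrite /= /d0 -pE sp.
rewrite -big_split /=; apply: eq_bigr => d _.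
rewrite -big_split /=; apply: eq_big_seq => p /irrsP[mp sp ip].
have [->|neq] := eqVneq p p0; last first.
  rewrite mul0n addn0; apply: eq_bigr => k _; congr (nat_of_bool _ * _)%N.
  by rewrite gE Gauss_dvdpr // coprimep_expl // coprimep_irreducible.
rewrite mul1n -!big_distrl /= addnC -mulSn; congr (_ * _)%N.
have p0N0 : p0 != 0 by rewrite monic_neq0.
have E k : (p0 ^+ k.+1 %| g) = (p0 ^+ k %| g') by rewrite gE exprS dvdp_mul2l.
rewrite (eq_bigr (fun k : 'I_B => nat_of_bool (p0 ^+ k %| g')%R)) => [|k _]; last by rewrite E.
case: B d0B le_nB {IH d sp} => [|B] d0B le_nB; first by lia.
rewrite big_ord_recl expr0 dvd1p add1n; congr _.+1.
(* The top exponent contributes nothing: that power of [p0] has larger degree than [g']. *)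
rewrite [RHS]big_ord_recr /= [X in (_ + X)%N](_ : _ = 0)%N ?addn0 //.
suff -> : (p0 ^+ B.+1 %| g')%R = false by [].
apply/negP => /dvdp_leq; rewrite monic_neq0 // => /(_ isT).
rewrite leqNgt => /negP; apply.
have : (size (p0 ^+ B.+1)).-1 = (d0 * B.+1)%N by rewrite size_exp.
have := leq_pmull B.+1 d0_gt0; rewrite -(ltn_predK sg'0) -/n'.
by move: (size (p0 ^+ B.+1)); lia.
Qed.

Lemma mem_monicsX p d k : p \is monic -> size p = d.+1 -> p ^+ k \in monics (d * k)%N.
Proof.
move=> mp sp; rewrite mem_monics monic_exp //= -[d]/(d.+1.-1) -sp -size_exp prednK //.
by rewrite size_poly_gt0 expf_neq0 ?monic_neq0.
Qed.

Lemma sum_monics_dvd (R : nmodType) (f : {poly F} -> R) n d p : p \in monics d ->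
  \sum_(g <- monics n | p %| g) f g
  = if (d <= n)%N then \sum_(h <- monics (n - d)) f (p * h) else 0.
Proof.
rewrite mem_monics => /andP[mp /eqP sp].
have p0 : p != 0 by rewrite monic_neq0.
rewrite -big_filter; case: leqP => [le_dn|lt_nd].
  rewrite -[RHS](big_map (fun h => p * h) predT f); apply: perm_big.
  apply: uniq_perm; first by rewrite filter_uniq ?uniq_monics.
    by rewrite map_inj_uniq ?uniq_monics //; exact: mulfI.
  move=> g; rewrite mem_filter mem_monics.
  have sM h : h != 0 -> size (p * h) = (d + size h)%N.
    by move=> h0; rewrite size_monicM // sp.
  apply/idP/mapP => [/and3P[/dvdpP[h gE] mg /eqP sg]|[h]].
    have h0 : h != 0.
      by apply: contraTneq mg => h0; rewrite gE h0 mul0r monicE lead_coef0 eq_sym oner_eq0.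
    exists h; last by rewrite gE mulrC.
    rewrite mem_monics; move: mg sg; rewrite gE monicMr // => -> /=.
    by rewrite mulrC sM // => sg; rewrite -(eqn_add2l d) sg addnS subnKC.
  rewrite mem_monics => /andP[mh /eqP sh] ->.
  by rewrite dvdp_mulr ?dvdpp //= monicMl // mh sM ?monic_neq0 // sh addnS subnKC /=.
rewrite big_filter big_seq_cond big1 // => g /andP[]; rewrite mem_monics => /andP[mg /eqP sg].
by move/dvdp_leq; rewrite monic_neq0 // sp sg => /(_ isT); rewrite ltnS leqNgt lt_nd.
Qed.

(* Sum of [deg p * f (p ^ k)] over the monic irreducible [p] and [k] with [k * deg p = j]. *)
Definition psum (R : nmodType) (f : {poly F} -> R) j : R :=
  \sum_(d < j.+1 | (d %| j)%N) \sum_(p <- irrs d) f (p ^+ (j %/ d)%N) *+ d.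

(** This is the logarithmic derivative of the Euler product, obtained by double counting: replace
    [n] by the sum of [deg p] over the prime powers [p^k] dividing [g], exchange the sums, and write
    [g = p^k h]. *)
Lemma euler_newton (R : comNzRingType) (f : {poly F} -> R) n :
  (forall g h, g \is monic -> h \is monic -> f (g * h) = f g * f h) ->
  (\sum_(g <- monics n) f g) *+ n
  = \sum_(j < n) psum f j.+1 * \sum_(g <- monics (n - j.+1)) f g.
Proof.
move=> fM; pose A i := \sum_(g <- monics i) f g; rewrite -/(A n).
(* The guard kills prime powers of degree above [n], so that [d] and [k] may range over a full box
   before regrouping by [j = d k]. *)
pose G p (d k j : nat) := if (j <= n)%N then f (p ^+ k) *+ d * A (n - j)%N else 0.
transitivity (\sum_(d < n.+1) \sum_(p <- irrs d) \sum_(k < n) G p d k.+1 (d * k.+1)%N).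
  transitivity (\sum_(g <- monics n) \sum_(d < n.+1) \sum_(p <- irrs d)
     \sum_(k < n) if p ^+ k.+1 %| g then f g *+ d else 0).
    rewrite -sumrMnl; apply: eq_big_seq => g gm.
    rewrite -{1}(irr_multiplicity (leqnn n) gm) -sumrMnr; apply: eq_bigr => d _.
    rewrite -sumrMnr; apply: eq_bigr => p _; rewrite -sumrMnr.
    by apply: eq_bigr => k _; case: ifP; rewrite ?mul1n.
  rewrite exchange_big; apply: eq_bigr => d _.
  rewrite exchange_big; apply: eq_big_seq => p /irrsP[mp sp _].
  rewrite exchange_big; apply: eq_bigr => k _.
  rewrite -big_mkcond /= sumrMnl (sum_monics_dvd _ _ (mem_monicsX _ mp sp)) /G.
  case: ifP => _; last by rewrite mul0rn.
  rewrite mulrnAl; congr (_ *+ _); rewrite /A mulr_sumr; apply: eq_big_seq => h.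
  by rewrite mem_monics => /andP[mh _]; rewrite fM // monic_exp.
transitivity (\sum_(j < n) \sum_(d < n.+1 | (d %| j.+1)%N) \sum_(p <- irrs d)
   G p d (j.+1 %/ d)%N j.+1); last first.
  apply: eq_bigr => j _; rewrite mulr_suml.
  rewrite (big_ord_widen_cond n.+1 (fun d => d %| j.+1)%N
    (fun d => (\sum_(p <- irrs d) f (p ^+ (j.+1 %/ d)%N) *+ d) * A (n - j.+1)%N)) ?ltnS //.
  apply: eq_big => [d|d _].
    by rewrite ltnS; case: (boolP (d %| j.+1)%N) => //= /dvdn_leq ->.
  by rewrite mulr_suml; apply: eq_bigr => p _; rewrite /G ltn_ord.
rewrite (exchange_big_dep predT) //=; apply: eq_bigr => d _.
have [d0|d_gt0] := posnP d.
  rewrite big_seq big1 => [|p /irrsP[_ sp [s1 _]]]; last by move: s1; rewrite sp d0.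
  rewrite big1 // => j _; rewrite big_seq big1 // => p /irrsP[_ sp [s1 _]].
  by move: s1; rewrite sp d0.
rewrite [RHS]exchange_big; apply: eq_bigr => p _.
transitivity (\sum_(k < n) \sum_(j < n | j.+1 == (d * k.+1)%N) G p d k.+1 j.+1).
  apply: eq_bigr => k _; case: (leqP (d * k.+1)%N n) => [le_n|lt_n].
    have lt_j : ((d * k.+1).-1 < n)%N by rewrite prednK // muln_gt0 d_gt0.
    rewrite (big_pred1 (Ordinal lt_j)) /= ?prednK ?muln_gt0 ?d_gt0 // => j.
    by rewrite -[RHS]/(j == _ :> nat) -(eqSS j) prednK ?muln_gt0 ?d_gt0.
  rewrite /G leqNgt lt_n /= big1 // => j /eqP jE.
  by move: (ltn_ord j); rewrite jE leqNgt lt_n.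
rewrite (exchange_big_dep predT) //= [RHS]big_mkcond; apply: eq_bigr => j _.
case: ifP => [/dvdnP[k jE]|ndvd].
  have k_gt0 : (0 < k)%N by case: k jE.
  have lt_k : (k.-1 < n)%N.
    rewrite prednK // (leq_trans _ (ltn_ord j)) // jE leq_pmulr //.
  rewrite (big_pred1 (Ordinal lt_k)) /= ?prednK // => [|i].
    by rewrite jE mulnK.
  by rewrite -[RHS]/(i == _ :> nat) jE mulnC eqn_pmul2l // -(eqSS i) prednK // eq_sym.
by rewrite big1 // => k /eqP jE; move: ndvd; rewrite jE dvdn_mulr.
Qed.

(** Apply [euler_newton] to the constant 1: by induction every earlier summand equals [q^j], which
    leaves [q^j] for the last one. *)
Lemma psum_card (R : comNzRingType) j : (0 < j)%N ->
  psum (fun _ => 1) j = (#|F| ^ j)%:R :> R.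
Proof.
elim/ltn_ind: j => j IH j_gt0.
have := @euler_newton R (fun=> 1) j (fun _ _ _ _ => esym (mulr1 _)).
case: j j_gt0 IH => // j _ IH.
have A1 i : \sum_(g <- monics i) 1 = (#|F| ^ i)%:R :> R.
  by rewrite big_const_seq count_predT size_monics iter_addr addr0.
rewrite A1 big_ord_recr /= subnn A1 expn0 mulr1.
rewrite (eq_bigr (fun _ => (#|F| ^ j.+1)%:R)) => [|i _].
  by rewrite sumr_const card_ord mulrS addrC => /addrI ->.
by rewrite IH ?ltnS // A1 -natrM -expnD subnKC // ltnW // ltnS.
Qed.

End Monics.

Lemma expf_card_pred (F : finFieldType) (x : F) : x != 0 -> x ^+ #|F|.-1 = 1.
Proof.
move=> x0; apply: (mulfI x0).
by rewrite -exprS (ltn_predK (finNzRing_gt1 F)) expf_card mulr1.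
Qed.

Lemma natmulnE (x y : nat) : x *+ y = (x * y)%N.
Proof. by elim: y => [|y IH]; rewrite ?muln0 // mulrS IH mulnS. Qed.

(** * Linearity of sums over prime powers *)

Section Psum.
Variable F : finFieldType.
Implicit Types p g : {poly F}.

Lemma psum_natr (R : pzSemiRingType) (f : {poly F} -> nat) j :
  (psum f j)%:R = psum (fun g => (f g)%:R) j :> R.
Proof.
rewrite /psum natr_sum; apply: eq_bigr => d _; rewrite natr_sum.
by apply: eq_bigr => p _; rewrite natmulnE natrM mulr_natr.
Qed.

Lemma psum_eq (R : nmodType) (f f' : {poly F} -> R) j : f =1 f' -> psum f j = psum f' j.
Proof. by move=> E; apply: eq_bigr => d _; apply: eq_bigr => p _; rewrite E. Qed.

Lemma psumD (R : nmodType) (f f' : {poly F} -> R) j :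
  psum (fun g => f g + f' g) j = psum f j + psum f' j.
Proof.
rewrite /psum -big_split; apply: eq_bigr => d _; rewrite -big_split.
by apply: eq_bigr => p _; rewrite mulrnDl.
Qed.

Lemma psum_sum (R : pzSemiRingType) (I : finType) (w : I -> R) (f : I -> {poly F} -> R) j :
  psum (fun g => \sum_i w i * f i g) j = \sum_i w i * psum (f i) j.
Proof.
under [RHS]eq_bigr do rewrite /psum mulr_sumr.
rewrite [RHS]exchange_big; apply: eq_bigr => d _.
under [RHS]eq_bigr do rewrite mulr_sumr.
rewrite [RHS]exchange_big; apply: eq_bigr => p _.
by rewrite -sumrMnl; apply: eq_bigr => i _; rewrite mulrnAr.
Qed.

Lemma sum_irrs_pred1 B (P : pred nat) p d : size p = d.+1 ->
  (\sum_(k < B | P k) \sum_(p' <- irrs F k) (p' == p) * k <= d)%N.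
Proof.
move=> sp; have E k : (\sum_(p' <- irrs F k) (p' == p) * k <= (k == d) * k)%N.
  have [->|neq] := eqVneq k d.
    have [pi|pn] := boolP (p \in irrs F d).
      rewrite (bigD1_seq p) ?uniq_irrs //= eqxx big1 ?addn0 //.
      by move=> p' /negPf->.
    rewrite big_seq big1 // => p' pi'; case: eqP => // pE.
    by rewrite -pE pi' in pn.
  rewrite big_seq big1 // => p' /irrsP[_ sp' _]; case: eqP => // pE.
  by case/eqP: neq; apply: succn_inj; rewrite -sp' pE.
apply: (@leq_trans (\sum_(k < B) (k == d :> nat) * k)%N).
  by rewrite [leqLHS]big_mkcond; apply: leq_sum => k _; case: ifP => // _; apply: E.
case: (ltnP d B) => [lt_dB|le_Bd].
  rewrite (bigD1 (Ordinal lt_dB)) //= eqxx mul1n big1 ?addn0 // => k neq.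
  by rewrite -[k == d :> nat]/(k == Ordinal lt_dB) (negPf neq).
rewrite big1 // => k _; case: eqP => // kE; have := ltn_ord k.
by rewrite kE ltnNge le_Bd.
Qed.

End Psum.

Lemma prim_root_neq0 (R : nzRingType) n (z : R) : n.-primitive_root z -> z != 0.
Proof.
move=> zP; apply/eqP => z0; have := prim_expr_order zP.
by rewrite z0 expr0n gtn_eqF ?(prim_order_gt0 zP) //= => /esym/eqP; rewrite oner_eq0.
Qed.

(** * Power residue characters of monic polynomials and their L-polynomials *)

Section Characters.
Variables (F : finFieldType) (m : nat) (gam : F) (zeta : algC).
Hypothesis m_gt0 : (0 < m)%N.
Hypothesis m_dvd : (m %| #|F|.-1)%N.
Hypothesis gamP : (#|F|.-1).-primitive_root gam.
Hypothesis zetaP : m.-primitive_root zeta.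

(** Discrete logarithm to base [gam], with default value 0 at [x = 0]. *)
Definition lg (x : F) : nat :=
  oapp (fun i : 'I_#|F|.-1 => val i) 0%N [pick i : 'I_#|F|.-1 | x == gam ^+ i].

Lemma gam_neq0 : gam != 0.
Proof. exact: prim_root_neq0 gamP. Qed.

Lemma lgK x : x != 0 -> gam ^+ lg x = x.
Proof.
move=> x0; rewrite /lg; case: pickP => [i /eqP // | no].
by have [i xE] := prim_rootP gamP (expf_card_pred x0); have := no i; rewrite xE eqxx.
Qed.

Lemma lgM x y : x != 0 -> y != 0 -> lg (x * y) = lg x + lg y %[mod m].
Proof.
move=> x0 y0; have /eqP := lgK (mulf_neq0 x0 y0).
rewrite -{2}(lgK x0) -{2}(lgK y0) -exprD (eq_prim_root_expr gamP) => /eqP E.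
by rewrite -(modn_dvdm (lg (x * y)) m_dvd) E modn_dvdm.
Qed.

(** The [k]-th power of a multiplicative character of order [m]. It vanishes at 0 even for [k = 0],
    so the trivial character still detects zeros. *)
Definition psi k (x : F) : algC := if x == 0 then 0 else zeta ^+ (k * lg x).

Lemma psiM k x y : psi k (x * y) = psi k x * psi k y.
Proof.
rewrite /psi mulf_eq0; have [->|x0] := eqVneq x 0; first by rewrite /= mul0r.
have [->|y0] /= := eqVneq y 0; first by rewrite mulr0.
rewrite -exprD -mulnDr; apply/eqP; rewrite (eq_prim_root_expr zetaP).
by rewrite -modnMmr lgM // modnMmr.
Qed.

Lemma psi1 k : psi k 1 = 1.
Proof.
have E : psi k 1 * psi k 1 = psi k 1 by rewrite -psiM mulr1.
have N0 : psi k 1 != 0 by rewrite /psi oner_eq0 expf_neq0 // (prim_root_neq0 zetaP).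
by apply: (mulfI N0); rewrite E mulr1.
Qed.

Lemma psi_gam k : psi k gam = zeta ^+ k.
Proof.
rewrite /psi (negPf gam_neq0); apply/eqP; rewrite (eq_prim_root_expr zetaP).
have : gam ^+ lg gam == gam ^+ 1 by rewrite lgK ?gam_neq0.
rewrite (eq_prim_root_expr gamP) => /eqP E.
have {}E : lg gam = 1 %[mod m] by rewrite -(modn_dvdm (lg gam) m_dvd) E modn_dvdm.
by rewrite -modnMmr E modnMmr muln1.
Qed.

(** For nonzero [x] this is a geometric sum whose ratio [zeta^(lg x - t)] is an [m]-th root of
    unity. *)
Lemma psi_orth t x :
  \sum_(k < m) zeta ^- (k * t) * psi k x
  = ((x != 0) && (lg x == t %[mod m]))%:R * m%:R.
Proof.
have [->|x0] := eqVneq x 0.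
  by rewrite mul0r big1 // => k _; rewrite /psi eqxx mulr0.
have zN0 := prim_root_neq0 zetaP.
pose z := zeta ^+ lg x / zeta ^+ t.
transitivity (\sum_(k < m) z ^+ k).
  apply: eq_bigr => k _; rewrite /psi (negPf x0) /z exprMn exprVn -!exprM.
  by rewrite mulrC [(k * t)%N]mulnC [(k * lg x)%N]mulnC.
have zm : z ^+ m = 1.
  have e1 i : (zeta ^+ i) ^+ m = 1 by rewrite exprAC (prim_expr_order zetaP) expr1n.
  by rewrite exprMn exprVn !e1 divr1.
have -> : (lg x == t %[mod m]) = (z == 1).
  rewrite -(eq_prim_root_expr zetaP) /z -subr_eq0 -[RHS]subr_eq0.
  rewrite -[X in _ = (_ - X == 0)](@divff _ (zeta ^+ t)) ?expf_neq0 //.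
  by rewrite -mulrBl mulf_eq0 invr_eq0 (negPf (expf_neq0 t zN0)) orbF.
case: eqP => [->|/eqP z1] /=.
  by under eq_bigr do rewrite expr1n; rewrite sumr_const card_ord mul1r.
rewrite mul0r; apply/eqP; move: (subrX1 z m); rewrite zm subrr => /esym/eqP.
by rewrite mulf_eq0 subr_eq0 (negPf z1).
Qed.

Variables (d : nat) (beta : 'I_d -> F).
Hypothesis beta_inj : injective beta.
Hypothesis d_gt0 : (0 < d)%N.

(* With this sign, [sev g i] is the product of [z - beta i] over the roots [z] of [g]. *)
Definition sev (g : {poly F}) i : F := (-1) ^+ (size g).-1 * g.[beta i].

Lemma sevM g h i : g \is monic -> h \is monic -> sev (g * h) i = sev g i * sev h i.
Proof.
move=> mg mh; rewrite /sev size_monicM ?monic_neq0 // hornerM.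
have sg : (0 < size g)%N by rewrite size_poly_gt0 monic_neq0.
have sh : (0 < size h)%N by rewrite size_poly_gt0 monic_neq0.
rewrite mulrACA -exprD; congr (_ ^+ _ * _).
by move: (size g) (size h) sg sh; lia.
Qed.

Lemma sev_eq0 g i : (sev g i == 0) = root g (beta i).
Proof. by rewrite /sev mulf_eq0 signr_eq0. Qed.

Definition chi (r : {ffun 'I_d -> 'I_m}) (g : {poly F}) : algC := \prod_i psi (r i) (sev g i).

Lemma chiM r g h : g \is monic -> h \is monic -> chi r (g * h) = chi r g * chi r h.
Proof.
by move=> mg mh; rewrite /chi -big_split; apply: eq_bigr => i _; rewrite /= sevM // psiM.
Qed.

Lemma chi1 r : chi r 1 = 1.
Proof.
by rewrite /chi big1 // => i _; rewrite /sev size_poly1 expr0 mul1r hornerC psi1.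
Qed.

(* Adding a multiple of a Lagrange polynomial permutes the monic polynomials of degree [n]
   and multiplies the value at [beta i0], and only that one, by [gam]. *)
Lemma sum_chi_eq0 (r : {ffun 'I_d -> 'I_m}) i0 n : val (r i0) != 0%N -> (d <= n)%N ->
  \sum_(g <- monics F n) chi r g = 0.
Proof.
move=> ri0 le_dn.
pose l0 := \prod_(j | j != i0) ('X - (beta j)%:P).
have l0E i : i != i0 -> l0.[beta i] = 0.
  by move=> ni; rewrite /l0 (bigD1 i) //= hornerM hornerXsubC subrr mul0r.
have l00 : l0.[beta i0] != 0.
  rewrite horner_prod; apply/prodf_neq0 => j nj; rewrite hornerXsubC subr_eq0.
  by rewrite (inj_eq beta_inj) eq_sym.
pose l := l0.[beta i0]^-1 *: l0.
have lE i : l.[beta i] = (i == i0)%:R.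
  rewrite hornerZ; have [->|ni] := eqVneq i i0; first by rewrite mulVf.
  by rewrite (l0E i ni) mulr0.
(* The Lagrange polynomial has degree [d - 1 < n], so adding a multiple of it keeps [g] monic of
   degree [n]. *)
have sl : (size l <= n)%N.
  rewrite (leq_trans (size_scale_leq _ _)) // /l0 -big_filter size_prod_XsubC.
  set s := [seq _ <- _ | _].
  have us : uniq (i0 :: s) by rewrite /= mem_filter eqxx filter_uniq ?index_enum_uniq.
  apply: leq_trans le_dn; rewrite -[X in (_ <= X)%N]card_ord.
  by rewrite -[_.+1]/(size (i0 :: s)) -(card_uniqP us) max_card.
pose T g := g + ((gam - 1) * g.[beta i0]) *: l.
have TE g i : (T g).[beta i] = (if i == i0 then gam else 1) * g.[beta i].
  rewrite hornerD hornerZ lE; case: eqP => [->|_] /=; ring.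
have sT g : g \in monics F n -> size (T g) = n.+1 /\ T g \is monic.
  rewrite mem_monics => /andP[mg /eqP sg].
  have lt : (size (((gam - 1) * g.[beta i0]) *: l) < size g)%N.
    by rewrite sg ltnS (leq_trans (size_scale_leq _ _)).
  by rewrite size_polyDl // sg; split => //; rewrite monicE lead_coefDl // -monicE.
have T_inj : injective T.
  move=> g h E; have := congr1 (fun p => p.[beta i0]) E.
  rewrite /= !TE eqxx => /(mulfI gam_neq0) E0.
  by move: E; rewrite /T E0 => /addIr.
have pT : perm_eq (map T (monics F n)) (monics F n).
  have uT : uniq (map T (monics F n)) by rewrite map_inj_uniq ?uniq_monics.
  have [||_ eT] := uniq_min_size uT (s2 := monics F n).
  - by move=> _ /mapP[g gm ->]; have [s1 s2] := sT g gm; rewrite mem_monics s1 s2 eqxx.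
  - by rewrite (size_map T).
  by apply: uniq_perm => //; apply: uniq_monics.
have chiT g : g \in monics F n -> chi r (T g) = zeta ^+ r i0 * chi r g.
  move=> gm; have [s1 _] := sT g gm; move: gm; rewrite mem_monics => /andP[_ /eqP s2].
  rewrite /chi (bigD1 i0) //= [in RHS](bigD1 i0) //= mulrA; congr (_ * _).
    by rewrite /sev s1 s2 TE eqxx mulrCA psiM psi_gam.
  by apply: eq_bigr => i /negPf ni; rewrite /sev s1 s2 TE ni mul1r.
set Sg := \sum_(g <- _) _.
have E : Sg = zeta ^+ r i0 * Sg.
  rewrite {1}/Sg -(perm_big _ pT) /= big_map mulr_sumr.
  by apply: eq_big_seq => g /chiT.
have zr : zeta ^+ r i0 != 1.
  by rewrite -(prim_order_dvd zetaP) gtnNdvd // lt0n.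
apply/eqP; move/eqP: E; rewrite -subr_eq0 -{1}[Sg]mul1r -mulrBl mulf_eq0.
by rewrite subr_eq0 eq_sym (negPf zr).
Qed.

(** For nonzero [r] this truncation is the whole L-series, because the coefficients from degree [d]
    on vanish. *)
Definition Lpoly r := \poly_(n < d) \sum_(g <- monics F n) chi r g.

Lemma Lpoly_newton (r : {ffun 'I_d -> 'I_m}) i0 :
  val (r i0) != 0%N -> newton (Lpoly r) (psum (chi r)).
Proof.
move=> ri0; apply/newtonP => n.
have E i : (Lpoly r)`_i = \sum_(g <- monics F i) chi r g.
  by rewrite coef_poly; case: ltnP => // /(sum_chi_eq0 ri0) ->.
rewrite E euler_newton; last exact: chiM.
by apply: eq_bigr => j _; rewrite E.
Qed.

Lemma Lpoly0 r : (Lpoly r)`_0 = 1.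
Proof.
rewrite coef_poly d_gt0.
have -> : monics F 0 = [:: 1].
  apply: perm_small_eq => //; apply: uniq_perm; rewrite ?uniq_monics // => g.
  rewrite mem_monics inE; apply/andP/eqP => [[mg /size_poly1P[c c0 gE]] | ->].
    by move: mg; rewrite gE monicE lead_coefC => /eqP->.
  by rewrite monic1 size_poly1.
by rewrite big_seq1 chi1.
Qed.

Definition hit (tau : 'I_d -> nat) (g : {poly F}) : bool :=
  [forall i, (sev g i != 0) && (lg (sev g i) == tau i %[mod m])].

Definition bad (g : {poly F}) : bool := [exists i, sev g i == 0].

(** Up to the factor [m^d], these are the Fourier coefficients of the indicator [hit tau]. *)
Definition wt (tau : 'I_d -> nat) (r : {ffun 'I_d -> 'I_m}) : algC :=
  \prod_i zeta ^- (r i * tau i).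

Lemma chi_orth tau g : \sum_r wt tau r * chi r g = (m ^ d * hit tau g)%:R.
Proof.
transitivity (\prod_(i < d) \sum_(k < m) zeta ^- (k * tau i) * psi k (sev g i)).
  rewrite bigA_distr_bigA; apply: eq_bigr => r _.
  by rewrite /wt /chi -big_split.
under eq_bigr do rewrite psi_orth.
rewrite /hit; case: (boolP [forall _, _]) => [/forallP H|].
  under eq_bigr do rewrite H mul1r.
  by rewrite prodr_const card_ord muln1 natrX.
by rewrite negb_forall => /existsP[i /negPf H]; rewrite (bigD1 i) //= H mul0r mul0r muln0.
Qed.

Let r0 : {ffun 'I_d -> 'I_m} := [ffun=> Ordinal m_gt0].

Lemma wt0 tau : wt tau r0 = 1.
Proof. by rewrite /wt big1 // => i _; rewrite ffunE mul0n expr0 invr1. Qed.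

Lemma chi0 g : chi r0 g = 1 - (bad g)%:R.
Proof.
rewrite /bad; case: (boolP [exists _, _]) => [/existsP[i /eqP H]|].
  by rewrite subrr /chi (bigD1 i) //= H /psi eqxx mul0r.
rewrite negb_exists => /forallP H; rewrite subr0 /chi big1 // => i _.
by rewrite ffunE /psi (negPf (H i)) mul0n expr0.
Qed.

Lemma psum_chi0 j : (0 < j)%N ->
  psum (chi r0) j = #|F|%:R ^+ j - (psum (fun g => nat_of_bool (bad g)) j)%:R.
Proof.
move=> j_gt0; apply/eqP; rewrite eq_sym subr_eq; apply/eqP.
rewrite psum_natr -psumD -natrX -psum_card //; apply: psum_eq => g.
by rewrite chi0 subrK.
Qed.

(** Expand the indicator by orthogonality and isolate the trivial character, which gives the main
    term [q^j] up to the prime powers vanishing at some [beta i]. *)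
Lemma hit_count tau j : (0 < j)%N ->
  (m ^ d * psum (fun g => nat_of_bool (hit tau g)) j)%:R
  = #|F|%:R ^+ j - (psum (fun g => nat_of_bool (bad g)) j)%:R
    + \sum_(r | r != r0) wt tau r * psum (chi r) j.
Proof.
move=> j_gt0.
have -> : (m ^ d * psum (fun g => nat_of_bool (hit tau g)) j)%:R
   = psum (fun g => \sum_r wt tau r * chi r g) j.
  rewrite natrM psum_natr; transitivity (\sum_(i < 1) (m ^ d)%:R *
     psum (fun g => (hit tau g)%:R : algC) j); first by rewrite big_ord1.
  rewrite -psum_sum; apply: psum_eq => g.
  by rewrite big_ord1 chi_orth natrM.
by rewrite psum_sum (bigD1 r0) //= wt0 mul1r psum_chi0.
Qed.

(** A power of an irreducible [p] is bad only if [p] is one of the [d] linear polynomials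
    [X - beta i], each of which contributes at most 1. *)
Lemma bad_le j : (psum (fun g => nat_of_bool (bad g)) j <= d)%N.
Proof.
have -> : d = (\sum_(i < d) 1)%N by rewrite sum1_card card_ord.
have badE p k : irreducible_poly p -> p \is monic -> 
      (bad (p ^+ k)%R <= \sum_(i < d) (p == 'X - (beta i)%:P)%R)%N.
  move=> ip mp; rewrite /bad; case: (boolP [exists _, _]) => // /existsP[i].
  rewrite sev_eq0 /root horner_exp expf_eq0 => /andP[_ rp].
  rewrite (bigD1 i) //= (_ : p == _) //.
  rewrite -eqp_monic ?monicXsubC // eqp_sym.
  by case: ip => _; apply; rewrite ?size_XsubC // dvdp_XsubCl.
apply: (@leq_trans (\sum_(i < d) \sum_(k < j.+1 | (k %| j)%N)
    \sum_(p <- irrs F k) (p == 'X - (beta i)%:P)%R * k)%N); last first.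
  apply: leq_sum => i _.
  exact: (@sum_irrs_pred1 _ _ (fun k => k %| j)%N _ _ (size_XsubC (beta i))).
rewrite exchange_big; apply: leq_sum => k _ /=; rewrite exchange_big /=.
rewrite [leqLHS]big_seq [leqRHS]big_seq; apply: leq_sum => p /irrsP[mp _ ip].
by rewrite -big_distrl /= natmulnE leq_mul // badE.
Qed.

Lemma bad_gt0 : (0 < psum (fun g => nat_of_bool (bad g)) 1)%N.
Proof.
rewrite /psum (bigD1 (lift ord0 ord0)) //= addn_gt0; apply/orP; left.
have pi : 'X - (beta (Ordinal d_gt0))%:P \in irrs F (lift ord0 (ord0 : 'I_1)).
  apply/irrsP; rewrite monicXsubC size_XsubC; split => //; exact: irredp_XsubC.
rewrite (bigD1_seq _ pi) ?uniq_irrs //= addn_gt0; apply/orP; left.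
rewrite expr1 mulr1n /bad; case: (boolP [exists _, _]) => //.
by rewrite negb_exists => /forallP/(_ (Ordinal d_gt0)); rewrite sev_eq0 root_XsubC eqxx.
Qed.

Lemma nonzero_index r : r != r0 -> exists i, val (r i) != 0%N.
Proof.
move=> nr; apply/existsP; apply: contraR nr; rewrite negb_exists => /forallP H.
by apply/eqP/ffunP => i; apply/val_inj; have := H i; rewrite negbK ffunE => /eqP.
Qed.

Lemma Lprod_neq0 : (\prod_(r | r != r0) Lpoly r).[#|F|%:R^-1] != 0.
Proof.
have q_gt1 := finNzRing_gt1 F.
have HL r : r != r0 -> newton (Lpoly r) (psum (chi r)).
  by case/nonzero_index => i; apply: Lpoly_newton.
(* For [tau = 0] all weights are 1, so [hit_count] writes this sum as a natural number. It is
   positive for [j = 0] because [X - beta i] is bad. *)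
have T0 j : #|F|%:R ^+ j.+1 + \sum_(r | r != r0) psum (chi r) j.+1
  = (m ^ d * psum (fun g => nat_of_bool (hit (fun=> 0%N) g)) j.+1
     + psum (fun g => nat_of_bool (bad g)) j.+1)%:R.
  rewrite natrD hit_count // addrAC subrK; congr (_ + _); apply: eq_bigr => r _.
  by rewrite /wt big1 ?mul1r // => i _; rewrite muln0 expr0 invr1.
apply: (newton_nonvanishing _ _ (newton_prod HL)) => [||j|].
- exact: ltnW.
- rewrite -horner_coef0 horner_prod big1 // => r _.
  by rewrite horner_coef0 Lpoly0.
- by rewrite T0 ler0n.
by have := T0 0%N; rewrite expr1 => ->; rewrite ltr0n addn_gt0 bad_gt0 orbT.
Qed.

Theorem hit_density tau :
  exists2 M, (0 < M)%N & forall N0, exists2 N, (N0 < N)%N &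
    (#|F| ^ N <= M * psum (fun g => nat_of_bool (hit tau g)) N)%N.
Proof.
apply: (@recurrent_density _ (fun r => r != r0) Lpoly (fun r => psum (chi r)) (wt tau)
  _ (m ^ d) d _ (fun j => psum (fun g => nat_of_bool (bad g)) j)).
- exact: finNzRing_gt1.
- by move=> r /nonzero_index[i]; apply: Lpoly_newton.
- exact: Lprod_neq0.
- exact: bad_le.
by move=> j; apply: hit_count.
Qed.

End Characters.

(** * Frobenius and norms of linear factors *)

Lemma finField_card_pX (F : finFieldType) p :
  p \in [pchar F] -> exists n, #|F| = (p ^ n)%N.
Proof. by move=> pF; have := card_pprimeChar pF; rewrite /= => ->; eexists. Qed.

Lemma finField_pchar_nat (F : finFieldType) (L : fieldType) (phi : {rmorphism F -> L}) :
  [pchar L].-nat #|F|.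
Proof.
have [p p_pr pF] := finPcharP F; have [n Fn] := finField_card_pX pF.
by rewrite Fn pnatX pnatE // (rmorph_pchar phi pF).
Qed.

Section Frobenius.
Variables (F : finFieldType) (L : fieldType) (phi : {rmorphism F -> L}).

Lemma emb_expX s c : (phi c) ^+ (#|F| ^ s) = phi c.
Proof.
elim: s => [|s IH]; first by rewrite expr1.
by rewrite expnSr exprM IH -rmorphXn expf_card.
Qed.

Lemma frobD s (x y : L) :
  (x + y) ^+ (#|F| ^ s) = x ^+ (#|F| ^ s) + y ^+ (#|F| ^ s).
Proof. by rewrite exprDn_pchar // pnatX finField_pchar_nat. Qed.

Lemma frobB s (x y : L) :
  (x - y) ^+ (#|F| ^ s) = x ^+ (#|F| ^ s) - y ^+ (#|F| ^ s).
Proof. by apply/eqP; rewrite eq_sym subr_eq -frobD subrK. Qed.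

Lemma frob_horner s (h : {poly F}) (z : L) :
  (map_poly phi h).[z] ^+ (#|F| ^ s) = (map_poly phi h).[z ^+ (#|F| ^ s)].
Proof.
elim/poly_ind: h => [|h c IH].
  rewrite rmorph0 !horner0 expr0n expn_eq0 gtn_eqF //.
  exact: ltnW (finNzRing_gt1 F).
by rewrite rmorphD rmorphM /= map_polyX map_polyC /= !hornerMXaddC frobD exprMn IH emb_expX.
Qed.

End Frobenius.

(* The roots of [p] are the conjugates [z ^ (q ^ i)], [i < d], of any one of them. *)
Lemma linear_reciprocity (F : finFieldType) (p : {poly F}) d :
  p \is monic -> size p = d.+1 -> irreducible_poly p ->
  exists (L : fieldType) (phi : {rmorphism F -> L}) (z : L),
    (forall h, ((map_poly phi h).[z] == 0) = (p %| h)) /\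
    (forall b k, (z - phi b) ^+ (\sum_(i < d * k) #|F| ^ i)
        = phi ((-1) ^+ (d * k) * p.[b] ^+ k)).
Proof.
move=> mp sp ip; have q_gt1 := finNzRing_gt1 F.
have [L _ [z rz _]] := irredp_FAdjoin ip.
pose phi : {rmorphism F -> L} := GRing.in_alg L.
have {}rz : root (map_poly phi p) z := rz.
clearbody phi; exists L, phi, z.
have dvdE h : ((map_poly phi h).[z] == 0) = (p %| h).
  apply/idP/idP => [rh|/dvdpP[h' ->]]; last first.
    by rewrite rmorphM hornerM (eqP rz) mulr0.
  apply: contraLR rh; rewrite -irreducible_poly_coprime // => cop.
  rewrite -(coprimep_map phi) in cop.
  exact: coprimep_root cop rz.
(* If two conjugates agreed, [z] would be fixed by [x -> x^(q^s)] with [0 < s < d]. Then the [q^d]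
   distinct values [h(z)], for [h] of degree less than [d], would all be roots of [X^(q^s) - X]. *)
have conj_uniq : uniq [seq z ^+ (#|F| ^ i) | i <- iota 0 d].
  rewrite map_inj_in_uniq ?iota_uniq // => i j.
  rewrite !mem_iota !add0n /=; wlog le_ij : i j / (i <= j)%N => [W|] Hi Hj.
    by case/orP: (leq_total i j) => le E; [|apply/esym]; apply: W.
  move=> /eqP; rewrite -[in X in _ == X](subnK le_ij) expnD exprM -subr_eq0 -(frobB phi).
  rewrite expf_eq0 => /andP[_]; rewrite subr_eq0 => /eqP fixz.
  apply/eqP; rewrite eqn_leq le_ij leqNgt; apply/negP => lt_ij.
  set s := (j - i)%N in fixz.
  have s_lt : (s < d)%N by apply: leq_ltn_trans (leq_subr _ _) Hj.
  have s_gt0 : (0 < s)%N by rewrite subn_gt0.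
  pose r := [seq (map_poly phi h).[z] | h : {poly_d F}].
  have ur : uniq r.
    rewrite map_inj_uniq ?enum_uniq // => h h' E; apply/val_inj/eqP.
    rewrite -subr_eq0; apply/negPn/negP => nz.
    have : p %| polyn h - polyn h' by rewrite -dvdE rmorphB hornerD hornerN E subrr.
    move/dvdp_leq => /(_ nz); rewrite sp leqNgt ltnS => /negP; apply.
    by rewrite (leq_trans (size_polyD _ _)) // size_polyN geq_max !size_npoly.
  have qs_gt1 : (1 < #|F| ^ s)%N by rewrite -[1%N](exp1n s) ltn_exp2r.
  have sX : size ('X^(#|F| ^ s) - 'X : {poly L}) = (#|F| ^ s).+1.
    by rewrite size_polyDl size_polyXn // size_polyN size_polyX.
  have nzX : 'X^(#|F| ^ s) - 'X != 0 :> {poly L} by rewrite -size_poly_gt0 sX.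
  have ar : all (root ('X^(#|F| ^ s) - 'X)) r.
    apply/allP => _ /imageP[h _ ->]; rewrite rootE !hornerE frob_horner -fixz.
    by rewrite subrr.
  have := max_poly_roots nzX ar ur; rewrite sX size_image card_npoly ltnS.
  by rewrite leq_exp2l // leqNgt s_lt.
have pE : map_poly phi p = \prod_(i < d) ('X - (z ^+ (#|F| ^ i))%:P).
  rewrite (@all_roots_prod_XsubC _ (map_poly phi p) [seq z ^+ (#|F| ^ i) | i <- iota 0 d]).
  - rewrite lead_coef_map (monicP mp) rmorph1 scale1r big_map.
    by rewrite -[in LHS](subn0 d) -/(index_iota 0 d) big_mkord.
  - by rewrite size_map_poly size_map size_iota sp.
  - apply/allP => _ /mapP[i _ ->]; rewrite rootE -frob_horner (eqP rz).
    by rewrite expr0n expn_eq0 gtn_eqF // ltnW.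
  by rewrite uniq_rootsE.
split=> // b k.
(* The left side is the norm of [z - b], the product of its conjugates. *)
have base : (z - phi b) ^+ (\sum_(i < d) #|F| ^ i) = phi ((-1) ^+ d * p.[b]).
  rewrite rmorphM rmorphXn rmorphN rmorph1 -horner_map pE horner_prod.
  have -> : (-1) ^+ d = \prod_(i < d) (-1) :> L by rewrite prodr_const card_ord.
  rewrite -big_split /= expr_sum.
  apply: eq_bigr => i _; rewrite hornerXsubC mulN1r opprB (frobB phi).
  by rewrite emb_expX.
elim: k => [|k IH]; first by rewrite muln0 big_ord0 !expr0 mul1r rmorph1.
rewrite mulnS addnC big_split_ord /= exprD IH.
(* The next block of [d] exponents is the first one times [q^(dk)], and Frobenius fixes the norm. *)
have -> : (\sum_(i < d) #|F| ^ (d * k + i) = (\sum_(i < d) #|F| ^ i) * #|F| ^ (d * k))%N.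
  by rewrite big_distrl; apply: eq_bigr => i _; rewrite expnD mulnC.
rewrite [(z - phi b) ^+ _]exprM base emb_expX -rmorphM; congr (phi _).
by rewrite exprD exprS; ring.
Qed.

(** As [X^m - 1] is the product of the [Phi_d] with [d | m], [w] is a root of some [Phi_d], hence of
    [X^d - 1]; having order [m] forces [d = m]. *)
Lemma root_PhiF (F : finFieldType) m (w : F) :
  m.-primitive_root w -> root (PhiF F m) w.
Proof.
move=> wP; have m_gt0 := prim_order_gt0 wP.
have phiE n : (0 < n)%N -> \prod_(d <- divisors n) PhiF F d = 'X^n - 1.
  move=> n_gt0; rewrite /PhiF -rmorph_prod prod_Cyclotomic //.
  by rewrite rmorphB rmorph1 /= map_polyXn.
have : root (\prod_(d <- divisors m) PhiF F d) w.
  by rewrite phiE // rootE !hornerE (prim_expr_order wP) subrr.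
rewrite rootE horner_prod prodf_seq_eq0 => /hasP[d]; rewrite -dvdn_divisors // => d_m /= rd.
have d_gt0 : (0 < d)%N by apply: dvdn_gt0 d_m.
have : root ('X^d - 1) w.
  rewrite -phiE // (bigD1_seq d) ?divisors_uniq -?dvdn_divisors //=.
  by rewrite rootM /root rd.
rewrite rootE !hornerE subr_eq0 -(prim_order_dvd wP) => m_d.
have -> // : m = d by apply/eqP; rewrite eqn_dvd m_d d_m.
Qed.

(** * Irreducible common divisors and the degree of the gcd *)

Section Divisibility.
Variables (F : finFieldType) (m : nat) (gam : F).
Hypothesis m_dvd : (m %| #|F|.-1)%N.
Hypothesis gamP : (#|F|.-1).-primitive_root gam.
Variables (d : nat) (beta : 'I_d -> F).

(** Evaluate at a root [z] of [p]. The exponent [(q^(sk) - 1)/m] is [(q - 1)/m] times the sum of the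
    [q^i], so reciprocity turns that power of [a(z)] into a power of [om] with exponent the sum of
    the [e i * tau i]. Coprimality with [m] makes its [n]-th power a primitive [m]-th root of
    unity. *)
Lemma hit_dvd (tau e : 'I_d -> nat) (p : {poly F}) s k n :
  p \in irrs F s -> hit m gam beta tau (p ^+ k) ->
  coprime m (\sum_i e i * tau i) -> coprime m n ->
  p %| PhiF F m \Po (\prod_i ('X - (beta i)%:P) ^+ e i) ^+ (n * ((#|F| ^ (s * k)).-1 %/ m)).
Proof.
case/irrsP => mp sp ip /forallP hp cop_e cop_n.
have [L [phi [z [dvdE recip]]]] := linear_reciprocity mp sp ip.
pose om := gam ^+ (#|F|.-1 %/ m).
have omP : m.-primitive_root om by apply: dvdn_prim_root.
set a := \prod_i _.
have bE i : (z - phi (beta i)) ^+ ((#|F| ^ (s * k)).-1 %/ m) = phi (om ^+ tau i).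
  rewrite predn_exp mulnC -muln_divA // exprM recip -rmorphXn; congr (phi _).
  have /andP[nz /eqP lgE] := hp i.
  have sevE : sev beta (p ^+ k) i = (-1) ^+ (s * k) * p.[beta i] ^+ k.
    by rewrite /sev size_exp sp horner_exp.
  rewrite -sevE -(lgK gamP nz) exprAC; apply/eqP.
  by rewrite (eq_prim_root_expr omP); apply/eqP.
have aE : (map_poly phi a).[z] ^+ ((#|F| ^ (s * k)).-1 %/ m)
    = phi (om ^+ (\sum_i e i * tau i)).
  rewrite /a rmorph_prod horner_prod -prodrXl expr_sum rmorph_prod.
  apply: eq_bigr => i _.
  have -> : (map_poly phi (('X - (beta i)%:P) ^+ e i)).[z] = (z - phi (beta i)) ^+ e i.
    by rewrite rmorphXn /= horner_exp rmorphB /= map_polyX map_polyC hornerXsubC.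
  by rewrite exprAC bE -rmorphXn -exprM mulnC.
rewrite -dvdE map_comp_poly horner_comp rmorphXn horner_exp /= mulnC exprM aE.
rewrite -rmorphXn horner_map -exprM.
have -> : (PhiF F m).[om ^+ ((\sum_i e i * tau i) * n)] = 0; last by rewrite rmorph0.
apply/eqP/root_PhiF.
by rewrite prim_root_exp_coprime // coprime_sym coprimeMr cop_e cop_n.
Qed.

(** Each irreducible counted on the left divides [G], and its degree is charged against the
    exponent-one term of [irr_multiplicity]. *)
Lemma hit_sum_le (P : pred {poly F}) N (G : {poly F}) : G != 0 ->
  (forall s p, (s %| N)%N -> p \in irrs F s -> P (p ^+ (N %/ s)) -> p %| G) ->
  (psum (fun g => nat_of_bool (P g)) N <= (size G).-1)%N.
Proof.
move=> G0 dvdG; pose G1 := (lead_coef G)^-1 *: G.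
have c0 : (lead_coef G)^-1 != 0 by rewrite invr_eq0 lead_coef_eq0.
have G1m : G1 \in monics F (size G).-1.
  rewrite mem_monics monicE lead_coefZ mulVf ?lead_coef_eq0 // eqxx /=.
  by rewrite size_scale // prednK // size_poly_gt0.
set B := (maxn N (size G).-1).+1.
have le_B : ((size G).-1 <= B)%N by rewrite leqW // leq_maxr.
have NB : (N.+1 <= B.+1)%N by rewrite ltnS leqW // leq_maxl.
rewrite -(irr_multiplicity le_B G1m) /psum.
rewrite (big_ord_widen_cond B.+1 (fun s => s %| N)%N
  (fun s => \sum_(p <- irrs F s) nat_of_bool (P (p ^+ (N %/ s)%N)) *+ s)) //.
rewrite [leqLHS]big_mkcond; apply: leq_sum => s _; case: ifP => // /andP[sN _].
rewrite [leqLHS]big_seq [leqRHS]big_seq; apply: leq_sum => p pi.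
rewrite big_ord_recl expr1 /= (leq_trans _ (leq_addr _ _)) //.
case: (boolP (P _)) => [/(dvdG _ _ sN pi) pG|_]; last by rewrite mul0rn.
by rewrite natmulnE dvdpZr // pG.
Qed.

End Divisibility.

(** * Choice of the residue classes, and arithmetic for the exponent [n] *)

Lemma prime_avoid d (e f : 'I_d -> nat) l :
  (exists i, ~~ (l %| e i)%N) -> (exists i, ~~ (l %| f i)%N) ->
  exists tau : 'I_d -> nat, ~~ (l %| \sum_i e i * tau i)%N && ~~ (l %| \sum_i f i * tau i)%N.
Proof.
have sum1 (g : 'I_d -> nat) i : (\sum_j g j * (j == i) = g i)%N.
  rewrite (bigD1 i) //= eqxx muln1 big1 ?addn0 // => j /negPf->.
  by rewrite muln0.
case=> i ei [j fj].
have [fi|fi] := boolP (l %| f i)%N; last first.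
  by exists (fun k => k == i : nat); rewrite !sum1 ei fi.
have [ej|ej] := boolP (l %| e j)%N; last first.
  by exists (fun k => k == j : nat); rewrite !sum1 ej fj.
(* Here [l] divides [f i] and [e j], so in each of [e i + e j] and [f i + f j] exactly one term is
   not divisible by [l]. *)
exists (fun k => (k == i) + (k == j))%N.
have sum2 (g : 'I_d -> nat) : (\sum_k g k * ((k == i) + (k == j)) = g i + g j)%N.
  by under eq_bigr do rewrite mulnDr; rewrite big_split /= !sum1.
by rewrite !sum2 dvdn_addl // ei dvdn_addr.
Qed.

Lemma dvdn_sum_mod d (e t t' : 'I_d -> nat) l :
  (forall i, t i = t' i %[mod l]) ->
  (l %| \sum_i e i * t i)%N = (l %| \sum_i e i * t' i)%N.
Proof.
move=> E; rewrite /dvdn; congr (_ == _).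
rewrite -[LHS]modn_summ -[RHS]modn_summ; congr (_ %% _)%N.
by apply: eq_bigr => i _; rewrite -modnMmr E modnMmr.
Qed.

Lemma units_avoid d (e f : 'I_d -> nat) m : (0 < m)%N ->
  (forall l, prime l -> (l %| m)%N -> exists i, ~~ (l %| e i)%N) ->
  (forall l, prime l -> (l %| m)%N -> exists i, ~~ (l %| f i)%N) ->
  exists tau : 'I_d -> nat,
    coprime m (\sum_i e i * tau i) && coprime m (\sum_i f i * tau i).
Proof.
move=> m_gt0 He Hf.
have [tau tauP] : exists tau : 'I_d -> nat, forall l, l \in primes m ->
    ~~ (l %| \sum_i e i * tau i)%N && ~~ (l %| \sum_i f i * tau i)%N.
  have : all prime (primes m) by apply/allP => l; rewrite mem_primes => /andP[].
  have : {in primes m, forall l, l %| m}%N by move=> l; rewrite mem_primes => /and3P[].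
  elim: (primes m) (primes_uniq m) => [|l s IH] /=; first by exists (fun=> 0%N).
  move=> /andP[ls us] dvd_m /andP[l_pr s_pr].
  have [t1 t1P] : exists tau : 'I_d -> nat,
      ~~ (l %| \sum_i e i * tau i)%N && ~~ (l %| \sum_i f i * tau i)%N.
    by have lm := dvd_m l (mem_head _ _); apply: prime_avoid; [apply: He|apply: Hf].
  have [t2 t2P] : exists tau : 'I_d -> nat, forall l, l \in s ->
    ~~ (l %| \sum_i e i * tau i)%N && ~~ (l %| \sum_i f i * tau i)%N.
    by apply: IH => // l' l's; apply: dvd_m; rewrite inE l's orbT.
  have co : coprime l (\prod_(l' <- s) l').
    rewrite prime_coprime // Euclid_dvd_prod // big_has; apply/negP => /hasP[l' l's].
    by rewrite dvdn_prime2 ?(allP s_pr _ l's) // => /eqP E; rewrite E l's in ls.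
  exists (fun i => chinese l (\prod_(l' <- s) l') (t1 i) (t2 i)) => l'.
  rewrite inE => /orP[/eqP->|l's].
    have E i : chinese l (\prod_(l' <- s) l') (t1 i) (t2 i) = t1 i %[mod l].
      exact: chinese_modl.
    by rewrite !(dvdn_sum_mod _ E).
  have E i : chinese l (\prod_(l' <- s) l') (t1 i) (t2 i) = t2 i %[mod l'].
    have dl : (l' %| \prod_(l' <- s) l')%N by rewrite (big_rem l') //= dvdn_mulr.
    by rewrite -(modn_dvdm _ dl) chinese_modr // modn_dvdm.
  by rewrite !(dvdn_sum_mod _ E) t2P.
have copP x : (forall l, l \in primes m -> ~~ (l %| x)%N) -> coprime m x.
  move=> H; apply/negPn/negP => nco.
  have g_gt1 : (1 < gcdn m x)%N by rewrite ltn_neqAle eq_sym nco gcdn_gt0 m_gt0.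
  have := H (pdiv (gcdn m x)); rewrite mem_primes pdiv_prime // m_gt0 /=.
  rewrite (dvdn_trans (pdiv_dvd _) (dvdn_gcdl _ _)).
  by rewrite (dvdn_trans (pdiv_dvd _) (dvdn_gcdr _ _)) => /(_ isT).
by exists tau; rewrite !copP // => l /tauP/andP[].
Qed.

Lemma finField_gen (F : finFieldType) : exists g : F, (#|F|.-1).-primitive_root g.
Proof.
have q1 : (0 < #|F|.-1)%N by have := finNzRing_gt1 F; case: #|F| => [|[]].
have : has (#|F|.-1).-primitive_root (enum (predC1 (0 : F))).
  apply: has_prim_root => //; rewrite ?enum_uniq //; last by rewrite -cardE cardC1.
  apply/allP => x; rewrite mem_enum inE => x0; by rewrite unity_rootE expf_card_pred.
by case/hasP => g _ gP; exists g.
Qed.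

(** Both factors are -1 modulo [Q]. This inverts [q^K - 1] modulo [Q] when [n] is moved into its
    prescribed class. *)
Lemma mul_pred_modn Q w : (0 < Q)%N -> (0 < w)%N ->
  (Q.-1 * (Q * w).-1 = 1 %[mod Q])%N.
Proof.
move=> Q0 w0; apply/eqP; rewrite -(eqn_modDr (Q + Q * w)).
have -> : (Q.-1 * (Q * w).-1 + (Q + Q * w) = Q * w * Q + 1)%N.
  by case: Q Q0 => // Q _; case: w w0 => // w _; rewrite mulSn /=; nia.
have -> : (1 + (Q + Q * w) = w.+1 * Q + 1)%N by nia.
by rewrite !modnMDl.
Qed.

Lemma comp_PhiF_neq0 (F : finFieldType) m (a : {poly F}) n :
  (0 < m)%N -> (0 < n)%N -> (1 < size a)%N -> PhiF F m \Po a ^+ n != 0.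
Proof.
move=> m_gt0 n_gt0 a1; rewrite -size_poly_gt0.
have sP : size (PhiF F m) = (totient m).+1.
  rewrite -size_Cyclotomic size_map_poly_id0 // (monicP (Cyclotomic_monic m)).
  by rewrite rmorph1 oner_neq0.
have := size_comp_poly (PhiF F m) (a ^+ n); rewrite sP size_exp /= => E.
have : (0 < (size (PhiF F m \Po a ^+ n)).-1)%N.
  by rewrite E !muln_gt0 totient_gt0 m_gt0 n_gt0 -ltnS (ltn_predK a1) a1.
by case: (size _).
Qed.

(** * The case where [a] and [b] split and [m] divides [q - 1] *)

Section Split.
Variables (F : finFieldType) (m d : nat) (beta : 'I_d -> F) (e f : 'I_d -> nat).
Hypotheses (m_gt0 : (0 < m)%N) (m_dvd : (m %| #|F|.-1)%N).
Hypotheses (beta_inj : injective beta).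
Hypothesis He : forall l, prime l -> (l %| m)%N -> exists i, ~~ (l %| e i)%N.
Hypothesis Hf : forall l, prime l -> (l %| m)%N -> exists i, ~~ (l %| f i)%N.
Let a := \prod_i ('X - (beta i)%:P) ^+ e i.
Let b := \prod_i ('X - (beta i)%:P) ^+ f i.
Hypotheses (a1 : (1 < size a)%N) (b1 : (1 < size b)%N).

Lemma split_case Q k : (Q %| #|F| ^ k)%N ->
  exists2 M, (0 < M)%N & forall n0 N, exists n,
    [/\ (N < n)%N, n = n0 %[mod Q] &
        (n <= M * (size (gcdp (PhiF F m \Po a ^+ n) (PhiF F m \Po b ^+ n))).-1)%N].
Proof.
move=> Q_dvd; have q_gt1 := finNzRing_gt1 F.
have d_gt0 : (0 < d)%N.
  case: posnP => // d0; move: a1; rewrite /a big1 ?size_poly1 // => i.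
  by have := ltn_ord i; rewrite {2}d0.
have [gam gamP] := finField_gen F.
have [zeta zetaP] := C_prim_root_exists m_gt0.
have [tau /andP[cop_e cop_f]] := units_avoid m_gt0 He Hf.
have [M0 M0_gt0 dens] := hit_density m_gt0 m_dvd gamP zetaP beta_inj d_gt0 tau.
have Q_gt0 : (0 < Q)%N by apply: dvdn_gt0 Q_dvd; rewrite expn_gt0 ltnW.
have cop_Q : coprime m Q.
  apply: coprime_dvdr Q_dvd _; apply: coprimeXr; apply: coprime_dvdl m_dvd _.
  by rewrite -[X in coprime _ X](ltn_predK q_gt1) coprimenS.
exists (2 * Q * M0)%N => [|n0 N]; first by rewrite !muln_gt0 Q_gt0.
(* [K > k] makes [Q] divide [q^K], and [K > m (N + 1)] makes [(q^K - 1)/m] exceed [N]. *)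
have [K lt_K HK] := dens (k + m * N.+1)%N.
(* [n1] is 1 modulo [m] and [-m n0] modulo [Q]; as [m t = q^K - 1] is -1 modulo [Q], the product
   [n1 t] is [n0] modulo [Q]. Adding [m Q] after reduction keeps [n1] positive and at most
   [2 m Q]. *)
pose n1 := (chinese m Q 1 (Q.-1 * (m * n0)) %% (m * Q) + m * Q)%N.
have mQ_gt0 : (0 < m * Q)%N by rewrite muln_gt0 m_gt0.
have n1m : n1 = 1 %[mod m].
  by rewrite /n1 -modnDmr modnMr addn0 modn_dvdm ?dvdn_mulr // chinese_modl.
have n1Q : n1 = Q.-1 * (m * n0) %[mod Q].
  by rewrite /n1 addnC modnMDl modn_dvdm ?dvdn_mull // chinese_modr.
have n1_gt0 : (0 < n1)%N by rewrite /n1 addn_gt0 mQ_gt0 orbT.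
have n1_le : (n1 <= 2 * (m * Q))%N.
  by rewrite mul2n -addnn leq_add2r ltnW // ltn_mod.
pose t := ((#|F| ^ K).-1 %/ m)%N.
have tE : (m * t = (#|F| ^ K).-1)%N.
  by rewrite /t mulnC divnK // predn_exp dvdn_mulr.
have qK_gt0 : (0 < #|F| ^ K)%N by rewrite expn_gt0 ltnW.
have t_gt : (N < t)%N.
  have : (m * N.+1 <= m * t)%N.
    rewrite tE -ltnS prednK //; apply: leq_ltn_trans (ltn_expl K q_gt1).
    by apply: leq_trans (ltnW lt_K); rewrite leq_addl.
  by rewrite leq_pmul2l.
have t_gt0 : (0 < t)%N by apply: leq_trans t_gt.
exists (n1 * t)%N; split.
- by apply: leq_trans t_gt _; rewrite leq_pmull.
- have /dvdnP[w qKE] : (Q %| #|F| ^ K)%N.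
    apply: dvdn_trans Q_dvd _; apply: dvdn_exp2l.
    by apply: leq_trans (ltnW lt_K); rewrite leq_addr.
  have w_gt0 : (0 < w)%N by case: w qKE qK_gt0 => // ->.
  rewrite -modnMml n1Q modnMml.
  have -> : (Q.-1 * (m * n0) * t = n0 * (Q.-1 * (Q * w).-1))%N.
    by rewrite [(Q * w)%N]mulnC -qKE -tE; nia.
  by rewrite -modnMmr mul_pred_modn // modnMmr muln1.
set G := gcdp _ _.
have nt_gt0 : (0 < n1 * t)%N by rewrite muln_gt0 n1_gt0.
have G0 : G != 0 by rewrite gcdp_eq0 negb_and comp_PhiF_neq0.
have cop_n1 : coprime m n1 by rewrite -coprime_modr n1m coprime_modr coprimen1.
have le_G : (psum (fun g => nat_of_bool (hit m gam beta tau g)) K <= (size G).-1)%N.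
  apply: hit_sum_le => // s p sK pi hp.
  have KE : (s * (K %/ s) = K)%N by rewrite mulnC divnK.
  rewrite dvdp_gcd /t -KE; apply/andP.
  by split; apply: (hit_dvd m_dvd gamP pi hp).
(* The chain is [n1 t <= 2 m Q t <= 2 Q q^K <= 2 Q M0 deg G]. *)
apply: (@leq_trans (2 * Q * #|F| ^ K)%N).
  apply: (@leq_trans (2 * (m * Q) * t)%N); first by rewrite leq_mul2r n1_le orbT.
  have : (m * t <= #|F| ^ K)%N by rewrite tE leq_pred.
  by move/(leq_mul (leqnn (2 * Q)%N)); nia.
rewrite -!mulnA !leq_mul2l /=; apply/orP; right.
by apply: leq_trans HK _; rewrite leq_mul2l le_G orbT.
Qed.
End Split.

(** * Passage to a splitting field and descent of powers *)

Lemma finField_natr_neq0 (F : finFieldType) m : coprime m #|F| -> m%:R != 0 :> F.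
Proof.
have [p p_pr pF] := finPcharP F; rewrite -(dvdn_pcharf pF) => cop; apply/negP => p_m.
have p_q : (p %| #|F|)%N.
  have [n qE] := finField_card_pX pF; have := finNzRing_gt1 F.
  by rewrite qE; case: n {qE} => // n _; rewrite expnS dvdn_mulr.
have : (p %| gcdn m #|F|)%N by rewrite dvdn_gcd p_m.
by rewrite (eqP cop) dvdn1 => /eqP p1; rewrite p1 in p_pr.
Qed.

Lemma frobenius_morphism (F : finFieldType) (K : fieldType) (phi : {rmorphism F -> K}) :
  exists sigma : {rmorphism K -> K}, forall x, sigma x = x ^+ #|F|.
Proof.
have [p p_pr pF] := finPcharP F; have pK := rmorph_pchar phi pF.
have [n ->] := finField_card_pX pF.
elim: n => [|n [sigma E]]; first by exists idfun.
by exists (pFrobenius_aut pK \o sigma) => x; rewrite /= E pFrobenius_autE -exprM expnSr.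
Qed.

(** [X^q - X] is the product of the [X - x] over [x] in [F], so its roots in [K] are the images of
    elements of [F]. *)
Lemma frobenius_fixed (F : finFieldType) (K : fieldType) (phi : {rmorphism F -> K}) y :
  y ^+ #|F| = y -> exists x, phi x = y.
Proof.
move=> fix_y; have : (map_poly phi ('X^#|F| - 'X)).[y] == 0.
  by rewrite rmorphB /= map_polyXn map_polyX !hornerE fix_y subrr.
rewrite finField_genPoly rmorph_prod horner_prod => /prodf_eq0[x _].
rewrite rmorphB /= map_polyX map_polyC hornerXsubC subr_eq0 => /eqP yE.
by exists x.
Qed.

(** In the factorization of [c^l - c'^l], the cofactor of [c - c'] is a sum of [l] monic polynomials
    of equal degree, so its leading coefficient is [l], which is nonzero. *)
Lemma monic_expI (R : idomainType) (c c' : {poly R}) l :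
  l%:R != 0 :> R -> c \is monic -> c' \is monic -> size c = size c' ->
  c ^+ l = c' ^+ l -> c = c'.
Proof.
move=> l0 mc mc' sc E; apply/eqP; rewrite -subr_eq0.
have /eqP : (c - c') * \sum_(i < l) c ^+ (l.-1 - i) * c' ^+ i = 0 by rewrite -subrXX E subrr.
rewrite mulf_eq0 => /orP[//|/eqP S0].
have := congr1 (fun p : {poly R} => p`_((size c).-1 * l.-1)) S0.
rewrite coef_sum coef0 => /eqP; rewrite (eq_bigr (fun=> 1)) => [|i _].
  by rewrite sumr_const card_ord (negPf l0).
have m1 : c ^+ (l.-1 - i) * c' ^+ i \is monic by rewrite monicMl ?monic_exp.
have <- : (size (c ^+ (l.-1 - i) * c' ^+ i)).-1 = ((size c).-1 * l.-1)%N.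
  have e1 := size_exp c (l.-1 - i); have e2 := size_exp c' i.
  have z1 : (0 < size (c ^+ (l.-1 - i)))%N by rewrite size_poly_gt0 monic_neq0 ?monic_exp.
  have z2 : (0 < size (c' ^+ i))%N by rewrite size_poly_gt0 monic_neq0 ?monic_exp.
  rewrite size_monicM ?monic_exp // ?monic_neq0 ?monic_exp //.
  rewrite -[l.-1 in RHS](@subnK i) ?mulnDr; last by have := ltn_ord i; lia.
  by rewrite -e1 [in RHS]sc -e2; move: (size _) (size _) z1 z2; lia.
by rewrite -lead_coefE (monicP m1).
Qed.

Lemma prod_XsubC_count (K : finFieldType) (s : seq K) :
  \prod_(z <- s) ('X - z%:P) = \prod_(x : K) ('X - x%:P) ^+ count_mem x s.
Proof.
elim: s => [|z s IH]; first by rewrite big_nil big1.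
rewrite big_cons IH /=.
rewrite [RHS](eq_bigr (fun x => ('X - x%:P) ^+ (z == x) * ('X - x%:P) ^+ count_mem x s)).
  rewrite big_split /=; congr (_ * _).
  rewrite (bigD1 z) //= eqxx expr1 big1 ?mulr1 // => x /negPf nx.
  by rewrite eq_sym nx.
by move=> x _; rewrite exprD.
Qed.

(* An l-th root of [a] is unique among monic polynomials, hence fixed by Frobenius. *)
Lemma descend_power (F K : finFieldType) (phi : {rmorphism F -> K})
    (a : {poly F}) (c : {poly K}) l :
  l%:R != 0 :> F -> c \is monic -> map_poly phi a = c ^+ l -> exists c0, c0 ^+ l = a.
Proof.
move=> l0 mc aE; have [sigma sE] := frobenius_morphism phi.
have sc : map_poly sigma c = c.
  apply: (@monic_expI _ _ _ l); rewrite ?map_monic ?size_map_poly //.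
    by rewrite -(rmorph_nat phi) fmorph_eq0.
  rewrite -rmorphXn -aE /= -map_poly_comp; apply: eq_map_poly => x /=.
  by rewrite sE -rmorphXn expf_card.
have ex i : exists x, phi x == c`_i.
  have [|x xE] := @frobenius_fixed F K phi c`_i; last by exists x; rewrite xE.
  by rewrite -sE -coef_map sc.
exists (\poly_(i < size c) xchoose (ex i)).
apply: (map_poly_inj phi); rewrite rmorphXn aE; congr (_ ^+ _).
apply/polyP => i; rewrite coef_map coef_poly; case: ltnP => [_|le].
  exact/eqP/(xchooseP (ex i)).
by rewrite [RHS]nth_default // raddf0.
Qed.

Lemma split_extension (F : finFieldType) (p : {poly F}) : p != 0 ->
  exists (K : finFieldType) (phi : {rmorphism F -> K}) (rs : seq K),
    (exists r, #|K| = (#|F| ^ r)%N /\ (0 < r)%N) /\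
    map_poly phi p %= \prod_(z <- rs) ('X - z%:P).
Proof.
move=> p0; have [L [rs rsE _]] := FinSplittingFieldFor p0.
exists (FinFieldExtType L), (GRing.in_alg L), rs; split=> //.
exists (\dim {: L}); split; last exact: adim_gt0.
by have := @card_vspacef F (FinFieldExtType L) (Vector.class L); rewrite card_vspace => <-.
Qed.

Lemma split_dvd (F K : finFieldType) (phi : {rmorphism F -> K}) (p g : {poly F}) rs :
  map_poly phi p %= \prod_(z <- rs) ('X - z%:P) -> g %| p -> g \is monic ->
  exists s, map_poly phi g = \prod_(z <- s) ('X - z%:P).
Proof.
move=> rsE gp mg; have : map_poly phi g %| \prod_(z <- rs) ('X - z%:P).
  by rewrite -(eqp_dvdr _ rsE) dvdp_map.
case/dvdp_prod_XsubC => msk E; exists (mask msk rs); apply/eqP.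
by rewrite -eqp_monic ?map_monic // monic_prod_XsubC.
Qed.

(** Letting the roots run over all of [K], with exponent zero allowed, puts [a] and [b] over the
    same family [beta]. *)
Lemma split_exponents (F K : finFieldType) (phi : {rmorphism F -> K}) (a : {poly F}) s :
  map_poly phi a = \prod_(z <- s) ('X - z%:P) ->
  map_poly phi a = \prod_(i < #|K|) ('X - (enum_val i)%:P) ^+ count_mem (enum_val i) s.
Proof. by move=> ->; rewrite prod_XsubC_count big_enum_val. Qed.

(** If [l] divided every exponent, [a] would be the [l]-th power of a monic polynomial over [K], and
    this root descends to [F]. *)
Lemma nonpower_exponent (F K : finFieldType) (phi : {rmorphism F -> K}) (a : {poly F})
    d (beta : 'I_d -> K) (e : 'I_d -> nat) l :
  map_poly phi a = \prod_i ('X - (beta i)%:P) ^+ e i -> l%:R != 0 :> F ->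
  ~ is_pow_in_FT l a -> exists i, ~~ (l %| e i)%N.
Proof.
move=> aE l0 npow; case: (boolP [exists i, ~~ (l %| e i)%N]) => [/existsP //|].
rewrite negb_exists => /forallP all_l; case: npow.
pose c := \prod_i ('X - (beta i)%:P) ^+ (e i %/ l).
have mc : c \is monic by apply: monic_prod => i _; rewrite monic_exp ?monicXsubC.
have [c0 c0E] : exists c0, c0 ^+ l = a.
  apply: (descend_power (phi := phi) l0 mc); rewrite aE /c -prodrXl; apply: eq_bigr => i _.
  by rewrite -exprM divnK //; apply/negPn; rewrite all_l.
by exists (tofrac c0); rewrite -rmorphXn c0E.
Qed.

(** [X^m - 1] is separable, so its [m] distinct roots in [K] include a primitive one, whose order
    divides that of the unit group. *)
Lemma split_unity_order (K : finFieldType) m (s : seq K) :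
  (0 < m)%N -> m%:R != 0 :> K -> 'X^m - 1 = \prod_(z <- s) ('X - z%:P) ->
  (m %| #|K|.-1)%N.
Proof.
move=> m_gt0 m0 sE.
have us : uniq s by rewrite -separable_prod_XsubC -sE separable_Xn_sub_1.
have : has m.-primitive_root s.
  apply: has_prim_root => //; last first.
    by rewrite -ltnS -(size_prod_XsubC s id) -sE size_XnsubC.
  by apply/allP => z zs; rewrite /root_of_unity sE root_prod_XsubC.
case/hasP => w _ wP.
by rewrite (prim_order_dvd wP) expf_card_pred // (prim_root_neq0 wP).
Qed.

Theorem theorem3p1 (F : finFieldType) (m : nat) (a b : {poly F}) (k : nat) :
  (0 < m)%N -> coprime m #|F| ->
  a \is monic -> (1 < size a)%N ->
  b \is monic -> (1 < size b)%N ->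
  (forall l : nat, prime l -> (l %| m)%N ->
     ~ is_pow_in_FT l a /\ ~ is_pow_in_FT l b) ->
  exists c : rat, 0 < c /\
    forall (n0 N : nat), exists n : nat,
      [/\ (N < n)%N, n = n0 %[mod #|F| ^ k] &
        c * n%:R <= ((size (gcdp (PhiF F m \Po a ^+ n) (PhiF F m \Po b ^+ n))).-1)%:R].
Proof.
move=> m_gt0 cop_m ma a1 mb b1 npow.
have mX : 'X^m - 1 \is @monic F by rewrite -[1]/(1%:P) monicXnsubC.
(* Splitting this product at once splits [a] and [b] and provides the [m]-th roots of unity. *)
have p0 : a * b * ('X^m - 1) != 0 by rewrite !mulf_neq0 ?monic_neq0.
have [K [phi [rs [[r [cardK r_gt0]] rsE]]]] := split_extension p0.
have [|s sE] := split_dvd rsE _ mX; first by rewrite dvdp_mull.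
have [|sa saE] := split_dvd rsE _ ma; first by rewrite -mulrA dvdp_mulr.
have [|sb sbE] := split_dvd rsE _ mb; first by rewrite mulrAC dvdp_mull.
have m_dvd : (m %| #|K|.-1)%N.
  apply: (@split_unity_order _ _ s) => //; last first.
    by rewrite -sE rmorphB /= map_polyXn rmorph1.
  by rewrite -(rmorph_nat phi) fmorph_eq0 finField_natr_neq0.
have aE := split_exponents saE; have bE := split_exponents sbE.
have l0 l : (l %| m)%N -> l%:R != 0 :> F.
  by move=> lm; rewrite finField_natr_neq0 // (coprime_dvdl lm).
have He l : prime l -> (l %| m)%N -> exists i : 'I_#|K|, ~~ (l %| count_mem (enum_val i) sa)%N.
  by move=> pl lm; apply: (nonpower_exponent aE (l0 l lm)); case: (npow l pl lm).
have Hf l : prime l -> (l %| m)%N -> exists i : 'I_#|K|, ~~ (l %| count_mem (enum_val i) sb)%N.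
  by move=> pl lm; apply: (nonpower_exponent bE (l0 l lm)); case: (npow l pl lm).
have Q_dvd : (#|F| ^ k %| #|K| ^ k)%N.
  by rewrite dvdn_exp2r // cardK dvdn_exp.
have PhiK : PhiF K m = map_poly phi (PhiF F m).
  by rewrite /PhiF -map_poly_comp; apply: eq_map_poly => z /=; rewrite rmorph_int.
have [||M M_gt0 HM] := split_case m_gt0 m_dvd enum_val_inj He Hf _ _ Q_dvd.
- by rewrite -aE size_map_poly.
- by rewrite -bE size_map_poly.
exists M%:R^-1; split=> [|n0 N]; first by rewrite invr_gt0 ltr0n.
have [n [ltNn nE le_n]] := HM n0 N; exists n; split=> //.
rewrite ler_pdivrMl ?ltr0n // -natrM ler_nat; move: le_n.
(* Extending the constants commutes with the gcd and preserves its degree. *)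
by rewrite -aE -bE PhiK -!rmorphXn -!map_comp_poly -gcdp_map size_map_poly.
Qed.
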